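(* Let $k\ge 4$ and $0<d\le n$. Suppose $H$ is a $k$-graph on $n$ vertices with $\Delta_{k-2}(H)\le dn$ satisfying either of the following conditions: (1) there exists $\varepsilon>0$ such that $$\deg_H(S)\notin\left(n^{\frac{k-2}{k-1}-\varepsilon}d^{\frac1{k-1}+\varepsilon},\; n^{\frac{k-2}{k-1}}d^{\frac1{k-1}}\right)\quad\text{for every } S\in\binom{V(H)}{k-1};$$ (2) $$\deg_H(S)\notin\left(\frac{n^{\frac{k-2}{k-1}}d^{\frac1{k-1}}}{\left(\log\frac nd\right)^{k+1}},\; n^{\frac{k-2}{k-1}}d^{\frac1{k-1}}\right)\quad\text{for every } S\in\binom{V(H)}{k-1},$$ and $H$ has no $4$-cycle with clean intersections. Then $$\alpha(H)=\Omega\left(\left(\frac nd\log\frac nd\right)^{1/(k-1)}\right),$$ where the constant factor may depend on $\varepsilon$ in Case (1).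
   Context: A $k$-graph ($k$-uniform hypergraph) $H$ consists of a finite vertex set $V(H)$ and an edge set, which is a family of $k$-element subsets of $V(H)$. An independent set is a set of vertices containing no edge, and $\alpha(H)$ is the size of a largest independent set. For $S\subseteq V(H)$, $\deg_H(S)$ is the number of edges containing $S$; $\Delta_\ell(H)$ is the maximum of $\deg_H(S)$ over all $\ell$-subsets $S$ of $V(H)$. $\binom{V(H)}{k-1}$ is the family of $(k-1)$-subsets of $V(H)$, and $(a,b)$ is an open interval (empty if $a\ge b$; for $d=n$ the interval in (2) is read as empty). All logarithms are natural. The notation $\Omega$ is the standard asymptotic one with $n\to\infty$, where $k$ is fixed and the implied constant may depend on $k$ (and on $\varepsilon$ in Case (1)). A $4$-cycle consists of four distinct edges $e_1,e_2,e_3,e_4$ for which there exist distinct vertices $v_1,\dots,v_4$ with $v_i\in e_i\cap e_{i+1}$ for $i=1,\dots,4$ (where $e_5=e_1$). It has clean intersections if $e_1\cap e_3=\emptyset$ and $e_2\cap e_4=\emptyset$.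
   Formalization: If H has no edges, the formal theorem additionally requires dn ≥ 1; without this the claim fails, since an edgeless H has α(H) = n while (n/d)log(n/d) is unbounded as d → 0. An H with an edge satisfies dn ≥ 1 automatically. *)

(* Defs.v *)
From mathcomp Require Import all_boot all_order all_algebra.
From mathcomp Require Import all_reals exp.

Set Implicit Arguments.
Unset Strict Implicit.
Unset Printing Implicit Defensive.

Import Order.TTheory GRing.Theory Num.Theory.

Record kgraph (k : nat) (V : finType) := KGraph {
  edges : {set {set V}};
  edges_card : forall e, e \in edges -> #|e| = k }.

Section KGraph.
Variables (k : nat) (V : finType).
Implicit Types (H : kgraph k V) (S A : {set V}).

Definition independent H A : bool := [forall e in edges H, ~~ (e \subset A)].

Definition alpha H : nat := \max_(A : {set V} | independent H A) #|A|.

Definition deg H S : nat := #|[set e in edges H | S \subset e]|.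

Definition max_deg (l : nat) H : nat := \max_(S : {set V} | #|S| == l) deg H S.

Definition four_cycle H (e1 e2 e3 e4 : {set V}) : Prop :=
  [/\ [/\ e1 \in edges H, e2 \in edges H, e3 \in edges H & e4 \in edges H],
      uniq [:: e1; e2; e3; e4] &
      exists v1 v2 v3 v4 : V, uniq [:: v1; v2; v3; v4] /\
        [/\ v1 \in e1 :&: e2, v2 \in e2 :&: e3,
            v3 \in e3 :&: e4 & v4 \in e4 :&: e1]].

Definition clean_intersections (e1 e2 e3 e4 : {set V}) : Prop :=
  e1 :&: e3 = set0 /\ e2 :&: e4 = set0.

Definition no_clean_four_cycle H : Prop :=
  forall e1 e2 e3 e4,
    four_cycle H e1 e2 e3 e4 -> ~ clean_intersections e1 e2 e3 e4.

End KGraph.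

Local Open Scope ring_scope.

Section Conditions.
Variables (R : realType) (k n : nat) (d : R) (V : finType) (H : kgraph k V).

Definition degree_gap_power (eps : R) : Prop :=
  forall S : {set V}, #|S| = k.-1 ->
    (deg H S)%:R \notin
      `] n%:R `^ (k.-2%:R / k.-1%:R - eps) * d `^ (1 / k.-1%:R + eps),
         n%:R `^ (k.-2%:R / k.-1%:R) * d `^ (1 / k.-1%:R) [.

(* At d = n the logarithm vanishes and the interval is meant to be empty, but
   division by 0 yields 0 here; hence the guard d < n. *)
Definition degree_gap_log : Prop :=
  d < n%:R -> forall S : {set V}, #|S| = k.-1 ->
    (deg H S)%:R \notin
      `] n%:R `^ (k.-2%:R / k.-1%:R) * d `^ (1 / k.-1%:R)
           / ln (n%:R / d) ^+ k.+1,
         n%:R `^ (k.-2%:R / k.-1%:R) * d `^ (1 / k.-1%:R) [.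

(* For 0 < d < 1 / n the bound max_deg (k - 2) H <= d n only says that H has no
   edge; then alpha H = n, whereas (n / d) ln (n / d) is unbounded as d tends
   to 0.  Requiring d n >= 1 of edgeless H excludes only that degenerate case:
   an H with an edge satisfies d n >= 1 automatically. *)
Definition edgeless_scale : Prop := edges H = set0 -> 1 <= d * n%:R.

End Conditions.

(* Main.v *)
Require Import Defs.
From mathcomp Require Import all_boot all_order all_algebra.
From mathcomp Require Import all_reals exp.
From mathcomp Require Import sequences.
From mathcomp Require Import ring lra zify.

(** Write r = k - 1, x = n / d and m = x^(1/r).  A random set of about m
    vertices spans about m edges, so alpha(H) is at least of order m; the task
    is to gain the factor (ln x)^(1/r).

    Gibbs measure.  Let F be a hypergraph on a vertex set W of size N, with
    edges of size at most k and degrees of order t^(s-1) in size s.  Put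
    theta = eta (ln t)^(1/r) / t, the density that an independent set should
    reach, and lam = t^(-3/4).  Choose a random independent set I with
    probability proportional to
      lam^|I| exp (- sum_e theta^|e \ I|).
    The energy sum_e theta^|e \ I| is the expected number of edges completed by
    I together with a random set of density theta; it keeps I from containing
    too many almost complete edges.  The threat to v is
      Y_v(I) = sum_(e containing v) theta^|e \ (I + v)|,
    and adding v to I multiplies the weight by lam exp (- (1 - theta) Y_v(I)),
    or by 0 if an edge gets completed.  Two estimates oppose each other.

    - A vertex with a large threat is unlikely to belong to I, hence the
      threats to the members of I sum to at most O(ln t) |I| on average
      (gibbs_threat_le).  An edge e contributes |e \ I| theta^(|e \ I| - 1) to
      the threats outside I, and this exceeds its contribution to the threats
      inside I by a factor O(1 / theta) only (sum_threat_outside_le).  So if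
      E|I| were less than c theta N, the average threat would be at most a small
      multiple of ln t.
    - If the link of v splits into blocks of few edges that interact with each
      other through v only, then, conditionally on I outside the link, the
      blocks are independent, and v is free with probability at least
      exp (- 2 E Y_v) (inclusion_ge).  With the small average threat just
      obtained this gives E|I| >= t^(-7/8) N / 2, much more than c theta N.

    Together these give an independent set of size c theta N
    (independent_set_bound, clean_family_alpha_ge).

    Reduction.  Replace the edges of H that contain an r-set of degree at least
    n / m by that r-set (contraction).  In the resulting hypergraph the j-sets,
    1 <= j <= r - 1, have s-degree at most of order n^(s-j) / m^(s-1), and the
    r-sets have at most n / m extensions.  Take m = t^(4k) and sample vertices
    with probability m t / n.  The expected degrees become t^(s-1), whereas two
    vertices have codegree at most t^O(1) / m, a negative power of t.  So the
    pairs of edges with between 2 and r - 1 common vertices, and the triangles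
    formed with an edge that meets the two others in one vertex each, are
    destroyed by deleting few vertices; and no r-set has more than O(t)
    extensions (exists_clean_subset).  What remains are edges of size k with r
    common vertices.  Sharing two vertices is then an equivalence relation with
    classes of size O(t), and these classes provide the blocks of the links
    (cluster_edge, cluster_block).  The sample has about m t vertices, hence the
    independent set has size of order (ln t)^(1/r) m, where ln t is
    ln x / (4 k r).

    Both cases of the theorem are instances of alpha_ge_codegree. *)

Set Implicit Arguments.
Unset Strict Implicit.
Unset Printing Implicit Defensive.

Import Order.TTheory GRing.Theory Num.Theory.
Local Open Scope ring_scope.

(** * Sums over subsets and elementary inequalities *)

Section SubsetSums.
Variables (R : comPzRingType) (V : finType).
Implicit Types (A B I J K S : {set V}).

Lemma sum_subset_disjointU A B (h : {set V} -> R) : [disjoint A & B] ->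
  \sum_(I : {set V} | I \subset A :|: B) h I =
  \sum_(J : {set V} | J \subset A) \sum_(K : {set V} | K \subset B) h (J :|: K).
Proof.
move=> dAB; rewrite pair_big /=.
rewrite (reindex_onto (fun p : {set V} * {set V} => p.1 :|: p.2)
                      (fun I => (I :&: A, I :&: B))) /=; last first.
  by move=> I sI; rewrite -setIUr; apply/setIidPl.
have dab (J K : {set V}) : J \subset A -> K \subset B ->
    (J :|: K) :&: A = J /\ (J :|: K) :&: B = K.
  move=> sJ sK; rewrite !setIUl (setIidPl sJ) (setIidPl sK).
  have -> : K :&: A = set0.
    by apply/eqP; rewrite setI_eq0 disjoint_sym; apply: disjointWr sK dAB.
  have -> : J :&: B = set0.
    by apply/eqP; rewrite setI_eq0; apply: disjointWl sJ dAB.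
  by rewrite setU0 set0U.
apply: eq_bigl => -[J K] /=; rewrite xpair_eqE.
apply/idP/idP => [/and3P [_ /eqP <- /eqP <-]|/andP [sJ sK]].
  by rewrite !subsetIr.
by have [-> ->] := dab _ _ sJ sK; rewrite !eqxx setUSS.
Qed.

(** Summing a product of functions of the separate colour classes factors: this is
    the independence of the blocks of a link, in unnormalised form. *)
Lemma sum_subset_blocks (T : finType) (L : {set V}) (col : V -> T)
    (g : T -> {set V} -> R) (Lc := fun c => [set u in L | col u == c]) :
  \sum_(K : {set V} | K \subset L) \prod_c g c (K :&: Lc c) =
  \prod_c \sum_(K : {set V} | K \subset Lc c) g c K.
Proof.
rewrite (bigA_distr_big_dep (fun c K => K \subset Lc c)) /=.
rewrite (reindex_onto (fun f : {ffun T -> {set V}} => \bigcup_c f c)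
                      (fun K => [ffun c => K :&: Lc c])) /=; last first.
  move=> K sKL; apply/setP => u; apply/bigcupP/idP => [[c _]|uK].
    by rewrite ffunE inE => /andP [].
  by exists (col u) => //; rewrite ffunE !inE uK (subsetP sKL) /=.
have key (f : {ffun T -> {set V}}) c : f \in family (fun c K => K \subset Lc c) ->
    (\bigcup_c f c) :&: Lc c = f c.
  move=> /familyP fF; apply/setP => u; rewrite inE.
  apply/andP/idP => [[/bigcupP [c' _ uc']]|ufc].
    rewrite inE => /andP [uL /eqP cu].
    have := subsetP (fF c') _ uc'; rewrite inE => /andP [_ /eqP].
    by rewrite cu => ->.
  by split; [apply/bigcupP; exists c | exact: subsetP (fF c) _ ufc].
apply: eq_big => [f|f /andP [_ /eqP fE]]; last first.
  by apply: eq_bigr => c _; rewrite -[in RHS]fE ffunE.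
apply/andP/idP => [[_ /eqP <-]|fF].
  by apply/familyP => c; rewrite ffunE; exact: subsetIr.
split; last by apply/eqP/ffunP => c; rewrite ffunE key.
apply/bigcupsP => c _; apply: subset_trans (familyP fF c) _.
by apply/subsetP => u; rewrite inE => /andP [].
Qed.

End SubsetSums.

Section Jensen.
Variables (R : realType).

(** By the tangent line of the exponential at the barycentre. *)
Lemma Jensen_expR (I : finType) (P : pred I) (p x : I -> R) :
  (forall i, P i -> 0 <= p i) -> 0 < \sum_(i | P i) p i ->
  (\sum_(i | P i) p i) *
    expR ((\sum_(i | P i) p i * x i) / \sum_(i | P i) p i) <=
  \sum_(i | P i) p i * expR (x i).
Proof.
move=> p0 S0; set S := \sum_(i | P i) p i in S0 *.
set a := _ / S.
have -> : S * expR a =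
    \sum_(i | P i) (p i * (expR a * (1 + (x i - a)))).
  under eq_bigr => i _ do rewrite mulrCA.
  rewrite -mulr_sumr mulrC; congr (_ * _).
  under eq_bigr => i _ do rewrite mulrDr mulr1 mulrBr.
  rewrite big_split sumrB -mulr_suml /= -/S /a mulrCA divff ?gt_eqF //.
  by rewrite mulr1 subrr addr0.
apply: ler_sum => i Pi; rewrite ler_wpM2l ?p0 //.
have -> : expR (x i) = expR a * expR (x i - a) by rewrite -expRD addrC subrK.
by rewrite ler_wpM2l ?expR_ge0 // expR_ge1Dx.
Qed.

Lemma expRN_double_le (y : R) : 0 <= y <= 2^-1 -> expR (- (2 * y)) <= 1 - y.
Proof.
move=> /andP [y0 y1].
have h : 1 + 2 * y <= expR (2 * y) by exact: expR_ge1Dx.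
have e0 := expR_gt0 (2 * y).
rewrite expRN -[leLHS]mul1r ler_pdivrMr //.
apply: le_trans (_ : (1 - y) * (1 + 2 * y) <= _); first by nra.
by apply: ler_wpM2l => //; lra.
Qed.

Lemma mul_expRN_le1 (y : R) : y * expR (- y) <= 1.
Proof.
have h : 1 + y <= expR y by exact: expR_ge1Dx.
have e0 := expR_gt0 y.
by rewrite expRN ler_pdivrMr // mul1r; lra.
Qed.

End Jensen.

Lemma sum_subset_binomial (R : comPzRingType) (V : finType) (a b : R) (f : {set V}) :
  \sum_(K : {set V} | K \subset f) a ^+ #|K| * b ^+ #|f :\: K| =
  (a + b) ^+ #|f|.
Proof.
have -> : (a + b) ^+ #|f| =
    \prod_u ((if u \in f then a else 0) + (if u \in f then b else 1)).
  rewrite -prodr_const (big_mkcond (fun u => u \in f)) /=.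
  by apply: eq_bigr => u _; case: ifP => //; rewrite add0r.
rewrite bigA_distr /= [RHS](bigID (fun K : {set V} => K \subset f)) /=.
rewrite [X in _ = _ + X]big1 ?addr0; last first.
  move=> K /subsetPn [u uK uf].
  by rewrite (bigD1 u) //= uK (negPf uf) mul0r.
apply: eq_bigr => K sK.
rewrite [RHS](bigID (fun u => u \in K)) /=; congr (_ * _).
  rewrite -prodr_const; apply: eq_bigr => u uK.
  by rewrite uK (subsetP sK).
rewrite -prodr_const [RHS](bigID (fun u => u \in f)) /=.
rewrite [X in _ = _ * X]big1 ?mulr1; last first.
  by move=> u /andP [/negPf -> /negPf ->].
apply: eq_big => [u|u]; first by rewrite inE.
by rewrite inE => /andP [/negPf -> ->].
Qed.

Lemma prod_ge_1Bsum (R : realDomainType) (I : finType) (P : pred I)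
    (x y : I -> R) :
  (forall i, P i -> [/\ 0 <= x i, 0 <= y i & 1 - y i <= x i]) ->
  1 - \sum_(i | P i) y i <= \prod_(i | P i) x i.
Proof.
move=> H.
pose ok (s p : R) := [/\ 0 <= p, 0 <= s & 1 - s <= p].
suff [] : ok (\sum_(i | P i) y i) (\prod_(i | P i) x i) by [].
apply: (big_ind2 ok) => [|s1 p1 s2 p2 [a1 b1 c1] [a2 b2 c2]|i Pi].
- by split; rewrite ?ler01 // subr0.
- split; [exact: mulr_ge0|exact: addr_ge0|].
  have [h|h] := leP s1 1; first have [h'|h'] := leP s2 1; nra.
- by have [? ? ?] := H i Pi.
Qed.

Lemma sum_subset_with (R : nmodType) (V : finType) (W : {set V}) (v : V)
    (h : {set V} -> R) : v \in W ->
  \sum_(I : {set V} | (I \subset W) && (v \in I)) h I =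
  \sum_(I : {set V} | I \subset W :\ v) h (v |: I).
Proof.
move=> vW; rewrite (reindex_onto (fun I => v |: I) (fun I => I :\ v)) /=.
  apply: eq_bigl => I; rewrite setU11 andbT subsetD1 subUset sub1set vW /=.
  congr (_ && _); apply/eqP/idP => [<-|vI]; first by rewrite setD11.
  by rewrite setU1K.
by move=> I /andP [_ vI]; rewrite setD1K.
Qed.

(** * The Gibbs measure of a hypergraph *)

Section Gibbs.
Variables (R : realType) (V : finType) (F : {set {set V}}) (theta lam : R).
Hypothesis theta01 : 0 < theta <= 2^-1.
Hypothesis lam01 : 0 < lam <= 1.
Implicit Types (I J K e f : {set V}) (v : V).

(** The value 0 on complete edges makes the Gibbs measure live on independent
    sets; the other values penalise almost complete edges. *)
Definition edge_factor e I : R :=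
  if e \subset I then 0 else expR (- theta ^+ #|e :\: I|).

Definition gibbs I : R := lam ^+ #|I| * \prod_(e in F) edge_factor e I.

(** The factor theta^0 = 1 for an edge that v alone would complete makes the
    threat at least 1 whenever v is blocked. *)
Definition threat v I : R := \sum_(e in F | v \in e) theta ^+ #|e :\: (v |: I)|.

(** The factor by which adding v to I changes the weight of the edge e. *)
Definition keep v e I : R :=
  if e \subset v |: I then 0
  else expR (- ((1 - theta) * theta ^+ #|e :\: (v |: I)|)).

Let th0 : 0 < theta. Proof. by case/andP: theta01. Qed.
Let th1 : theta <= 1. Proof. by case/andP: theta01 => _ h; lra. Qed.
Let lam0 : 0 < lam. Proof. by case/andP: lam01. Qed.
Let lam1 : lam <= 1. Proof. by case/andP: lam01. Qed.
Let thX n : 0 <= theta ^+ n. Proof. by rewrite exprn_ge0 // ltW. Qed.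

Lemma edge_factor_ge0 e I : 0 <= edge_factor e I.
Proof. by rewrite /edge_factor; case: ifP => // _; exact: expR_ge0. Qed.

Lemma edge_factor_anti e I J : I \subset J -> edge_factor e J <= edge_factor e I.
Proof.
move=> sIJ; rewrite /edge_factor; case: ifP => [_|eJ].
  by case: ifP => // _; exact: expR_ge0.
rewrite ifF; last first.
  by apply: contraFF eJ => eI; exact: subset_trans eI sIJ.
rewrite ler_expR lerN2; apply: ler_wiXn2l => //; first exact: ltW.
by apply: subset_leq_card; exact: setDS.
Qed.

Lemma gibbs_ge0 I : 0 <= gibbs I.
Proof.
rewrite /gibbs mulr_ge0 ?exprn_ge0 ?(ltW lam0) // prodr_ge0 // => e _.
exact: edge_factor_ge0.
Qed.

Lemma threat_ge0 v I : 0 <= threat v I.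
Proof. by apply: sumr_ge0. Qed.

Lemma gibbs_neq0_indep I : gibbs I != 0 -> forall e, e \in F -> ~~ (e \subset I).
Proof.
move=> wI e eF; apply: contra_neqN wI => eI.
by rewrite /gibbs (bigD1 e) //= /edge_factor eI mul0r mulr0.
Qed.

Lemma keep_ge0 v e I : 0 <= keep v e I.
Proof. by rewrite /keep; case: ifP => // _; exact: expR_ge0. Qed.

Lemma keep_le1 v e I : keep v e I <= 1.
Proof.
rewrite /keep; case: ifP => // _; rewrite expR_le1 oppr_le0.
by rewrite mulr_ge0 ?subr_ge0.
Qed.

(** A blocking edge has theta^0 = 1, so that the left side vanishes; otherwise
    this is exp (-y) >= 1 - y. *)
Lemma keep_ge v e I : 1 - theta ^+ #|e :\: (v |: I)| <= keep v e I.
Proof.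
rewrite /keep; case: ifP => [|_].
  by rewrite -setD_eq0 => /eqP ->; rewrite cards0 expr0 subrr.
apply: le_trans (expR_ge1Dx _); rewrite lerD2l lerN2 ler_piMl // lerBlDr.
by rewrite lerDl ltW.
Qed.

Lemma gibbsU1 v I : v \notin I ->
  gibbs (v |: I) = lam * gibbs I * \prod_(e in F | v \in e) keep v e I.
Proof.
move=> vI; rewrite /gibbs cardsU1 vI exprS -!mulrA; congr (_ * (_ * _)).
rewrite (bigID (fun e : {set V} => v \in e)) /=.
rewrite [X in _ = X * _](bigID (fun e : {set V} => v \in e)) /=.
rewrite mulrAC -big_split /=; congr (_ * _); apply: eq_bigr => e /andP [_ ve].
  have -> : edge_factor e I = expR (- theta ^+ #|e :\: I|).
    by rewrite /edge_factor ifF //; apply: contraNF vI => /subsetP /(_ _ ve).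
  rewrite /edge_factor /keep; case: ifP => _; first by rewrite mulr0.
  rewrite -expRD; congr expR.
  have -> : #|e :\: I| = #|e :\: (v |: I)|.+1.
    rewrite (cardsD1 v (e :\: I)) !inE ve vI; congr (_.+1).
    by congr #|pred_of_set _|; rewrite setDDl setUC.
  by rewrite exprS; ring.
have eE : e :\: (v |: I) = e :\: I.
  apply/setP => u; rewrite !inE; case: eqP => // ->.
  by rewrite (negPf ve) !andbF.
by rewrite /edge_factor eE -setD_eq0 eE setD_eq0.
Qed.

Lemma prod_keep_le v I :
  \prod_(e in F | v \in e) keep v e I <= expR (- (threat v I / 2)).
Proof.
have -> : expR (- (threat v I / 2)) =
    \prod_(e in F | v \in e) expR (- (theta ^+ #|e :\: (v |: I)| / 2)).
  by rewrite -expR_sum sumrN -mulr_suml.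
apply: ler_prod => e _; rewrite keep_ge0 /= /keep.
case: ifP => _; first exact: expR_ge0.
rewrite ler_expR lerN2; have := thX #|e :\: (v |: I)|.
by case/andP: theta01 => _ h h'; nra.
Qed.

Lemma gibbsU1_le v I : v \notin I -> gibbs (v |: I) <= gibbs I.
Proof.
move=> vI; rewrite gibbsU1 //.
have p1 : \prod_(e in F | v \in e) keep v e I <= 1.
  by apply: prodr_ile1 => e _; rewrite keep_ge0 keep_le1.
apply: le_trans (_ : lam * gibbs I <= _).
  by rewrite ler_piMr // mulr_ge0 ?gibbs_ge0 // ltW.
by rewrite ler_piMl ?gibbs_ge0.
Qed.

(** If the threat exceeds M, the presence of v costs a factor exp (- threat / 2)
    against the configuration without v, and z exp (- z / 2) <= 4 exp (- M / 4)
    for z > M. *)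
Lemma gibbs_threat_le v I (M : R) : v \in I -> 0 <= M ->
  gibbs I * threat v I <= M * gibbs I + 4 * lam * expR (- (M / 4)) * gibbs (I :\ v).
Proof.
move=> vI M0; set J := I :\ v.
have YE : threat v I = threat v J.
  by rewrite /threat /J setD1K // (setUidPr _) // sub1set.
have wE : gibbs I = lam * gibbs J * \prod_(e in F | v \in e) keep v e J.
  by rewrite -gibbsU1 ?setD11 // setD1K.
have w0 := gibbs_ge0 I; have w1 := gibbs_ge0 J; have y0 := threat_ge0 v I.
have e0 := expR_ge0 (- (M / 4)).
have c0 : 0 <= 4 * lam * expR (- (M / 4)).
  by rewrite mulr_ge0 ?mulr_ge0 ?ler0n ?(ltW lam0).
have [yM|yM] := leP (threat v I) M.
  apply: le_trans (_ : M * gibbs I <= _); first by rewrite mulrC ler_wpM2r.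
  by rewrite lerDl (mulr_ge0 c0).
apply: le_trans (_ : 4 * lam * expR (- (M / 4)) * gibbs J <= _); last first.
  by rewrite lerDr (mulr_ge0 M0).
have h1 := prod_keep_le v J; rewrite -YE in h1.
have h2 : gibbs I * threat v I <= lam * gibbs J * expR (- (threat v I / 2)) * threat v I.
  by rewrite wE ler_wpM2r // ler_wpM2l // (mulr_ge0 (ltW lam0)).
apply: le_trans h2 _.
have -> : expR (- (threat v I / 2)) = expR (- (threat v I / 4)) * expR (- (threat v I / 4)).
  by rewrite -expRD; congr expR; field.
have h3 := mul_expRN_le1 (threat v I / 4).
have h4 : expR (- (threat v I / 4)) <= expR (- (M / 4)).
  by rewrite ler_expR; lra.
set a := expR (- (threat v I / 4)) in h3 h4 *.
have a0 : 0 <= a by exact: expR_ge0.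
have -> : lam * gibbs J * (a * a) * threat v I =
  4 * lam * a * gibbs J * (threat v I / 4 * a) by field.
apply: le_trans (_ : 4 * lam * a * gibbs J <= _).
  by rewrite ler_piMr // (mulr_ge0 _ w1) // mulr_ge0 // mulr_ge0 ?ler0n ?(ltW lam0).
by rewrite ler_wpM2r // ler_wpM2l // mulr_ge0 ?ler0n ?(ltW lam0).
Qed.

(** Seen from a vertex outside I, an edge e counts theta^(|e \ I| - 1); seen from
    a vertex of I, it counts theta^|e \ I|.  The passage from one to the other
    costs the factor k / theta; only edges disjoint from I are not seen from
    inside, whence the last sum. *)
Lemma sum_threat_outside_le (W I : {set V}) (k : nat) :
  (forall e, e \in F -> (#|e| <= k)%N) ->
  \sum_(v in W :\: I) threat v I <=
  k%:R / theta * (\sum_(v in I) threat v I + \sum_(e in F) theta ^+ #|e|).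
Proof.
move=> Fk.
have sumY (A : {set V}) : \sum_(v in A) threat v I =
    \sum_(e in F) \sum_(v in A | v \in e) theta ^+ #|e :\: (v |: I)|.
  rewrite /threat (exchange_big_dep (fun e => e \in F)) /=; last by move=> ? ? _ /andP[].
  by apply: eq_bigr => e eF; apply: eq_bigl => v; rewrite eF.
rewrite !sumY -big_split /= mulr_sumr; apply: ler_sum => e eF.
apply: le_trans (_ : \sum_(v in W :\: I | v \in e) theta ^+ #|e :\: I| / theta <= _).
  apply: ler_sum => v /andP [/setDP [_ vI] ve].
  have -> : #|e :\: I| = #|e :\: (v |: I)|.+1.
    rewrite (cardsD1 v (e :\: I)) !inE ve vI; congr (_.+1).
    by congr #|pred_of_set _|; rewrite setDDl setUC.
  by rewrite exprS mulrC mulKf // gt_eqF.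
rewrite sumr_const -[leLHS]mulr_natl.
have cle : (#|[pred v in W :\: I | v \in e]| <= k)%N.
  apply: leq_trans (Fk _ eF); apply: subset_leq_card.
  by apply/subsetP => v /andP [].
apply: le_trans (_ : k%:R * (theta ^+ #|e :\: I| / theta) <= _).
  by rewrite ler_wpM2r ?ler_nat // divr_ge0 // (ltW th0).
rewrite mulrA mulrAC ler_wpM2l ?divr_ge0 ?ler0n ?(ltW th0) //.
have [eI|/set0Pn [v]] := eqVneq (e :&: I) set0.
  apply: le_trans (_ : theta ^+ #|e| <= _); last by rewrite lerDr sumr_ge0.
  by rewrite (_ : e :\: I = e) //; apply/setDidPl; rewrite -setI_eq0 eI.
rewrite inE => /andP [ve vI].
rewrite (bigD1 v) /=; last by rewrite vI ve.
rewrite (_ : v |: I = I); last by rewrite (setUidPr _) // sub1set.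
by rewrite -addrA lerDl addr_ge0 // sumr_ge0.
Qed.

End Gibbs.

(** * Conditioning outside the link of a vertex *)

Section Local.
Variables (R : realType) (V : finType) (F : {set {set V}}) (theta lam : R).
Hypothesis theta01 : 0 < theta <= 2^-1.
Hypothesis lam01 : 0 < lam <= 2^-1.
Implicit Types (I J K e f : {set V}).

Let th0 : 0 < theta. Proof. by case/andP: theta01. Qed.
Let th1 : theta <= 1. Proof. by case/andP: theta01 => _ h; lra. Qed.
Let lam0 : 0 < lam. Proof. by case/andP: lam01. Qed.
Let thX n : 0 <= theta ^+ n. Proof. by rewrite exprn_ge0 // ltW. Qed.

Definition link (v : V) : {set V} :=
  (\bigcup_(e in F | v \in e) e) :\ v.

Variables (v : V) (T : finType) (col : V -> T) (m : nat).
Hypothesis Fcard : forall e, e \in F -> (3 <= #|e|)%N.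

Notation L := (link v).
(** Colour class of the link; the colours encode which edges at v are to be
    treated together. *)
Definition block c : {set V} := [set u in L | col u == c].

Hypothesis colP : forall e u u', e \in F -> u \in e :&: L -> u' \in e :&: L ->
  col u = col u'.
Hypothesis blockP : forall c,
  (#|[set e in F | (v \in e) && (e :&: block c != set0)]| <= m)%N.
Hypothesis m_small : m%:R * (theta + lam) ^+ 2 <= 2^-1.

Lemma block_sub c : block c \subset L.
Proof. by apply/subsetP => u; rewrite inE => /andP []. Qed.

Lemma edge_block c e : e \in F -> e :&: block c != set0 ->
  e :&: L \subset block c.
Proof.
move=> eF /set0Pn [u]; rewrite inE [u \in block c]inE => /andP [ue /andP [uL /eqP cu]].
apply/subsetP => u' u'eL; have ueL : u \in e :&: L by rewrite inE ue uL.
by rewrite inE -cu (colP eF u'eL ueL) eqxx andbT; case/setIP: u'eL.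
Qed.

Lemma edge_link e : e \in F -> v \in e -> e :\ v \subset L.
Proof.
move=> eF ve; apply/subsetP => u /setD1P [uv ue].
by rewrite inE inE uv /=; apply/bigcupP; exists e; rewrite ?eF.
Qed.

Lemma notin_link : v \notin L. Proof. by rewrite setD11. Qed.

(** The edges at v have another vertex, so each of them belongs to a block. *)
Lemma edge_meets_link e : e \in F -> v \in e -> e :&: L != set0.
Proof.
move=> eF ve; have := Fcard eF; rewrite (cardsD1 v) ve ltnS => h.
have /card_gt0P [u uev] : (0 < #|e :\ v|)%N by apply: leq_trans h.
apply/set0Pn; exists u; rewrite inE (subsetP (edge_link eF ve)) // andbT.
by case/setD1P: uev.
Qed.

(** An edge that meets the link meets exactly one block. *)
Lemma big_blocks (S : Type) (idx : S) (op : Monoid.com_law idx)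
    (Q : pred {set V}) (h : {set V} -> S) :
  \big[op/idx]_c \big[op/idx]_(e in F | Q e && (e :&: block c != set0)) h e =
  \big[op/idx]_(e in F | Q e && (e :&: L != set0)) h e.
Proof.
rewrite (exchange_big_dep (fun e => (e \in F) && (Q e && (e :&: L != set0)))).
  apply: eq_bigr => e /andP [eF /andP [Qe eL]].
  have [u ueL] := set0Pn _ eL.
  rewrite (big_pred1 (col u)) // => c; rewrite eF Qe /=.
  apply/set0Pn/eqP => [[u' /setIP [u'e]]|->].
    rewrite inE => /andP [u'L /eqP <-].
    by rewrite -(colP eF ueL) // inE u'e.
  by exists u; case/setIP: ueL => ue uL; rewrite inE ue inE uL eqxx.
move=> c e _ /and3P [-> -> /set0Pn [u /setIP [ue /(subsetP (block_sub c)) uL]]] /=.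
by apply/set0Pn; exists u; rewrite inE ue.
Qed.

Section Outside.
Variable J : {set V}.
Hypothesis JL : [disjoint J & L].
Hypothesis vJ : v \notin J.

Definition block_weight c K : R :=
  lam ^+ #|K| * \prod_(e in F | e :&: block c != set0) edge_factor theta e (J :|: K).

Definition block_threat c K : R :=
  \sum_(e in F | (v \in e) && (e :&: block c != set0))
     theta ^+ #|e :\: (v |: K)|.

Definition block_keep c K : R :=
  \prod_(e in F | (v \in e) && (e :&: block c != set0)) keep theta v e K.

Definition outside_weight : R :=
  lam ^+ #|J| * \prod_(e in F | e :&: L == set0) edge_factor theta e J.

Lemma setI_block c e K : e \in F -> e :&: block c != set0 -> K \subset L ->
  e :&: K = e :&: (K :&: block c).
Proof.
move=> eF ec KL; apply/setP => u; rewrite !inE.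
case ue: (u \in e) => //=; case uK: (u \in K) => //=.
have := subsetP (edge_block eF ec) u; rewrite inE ue (subsetP KL) // !inE.
by move=> /(_ isT) ->.
Qed.

Lemma edge_factor_block c e K : e \in F -> e :&: block c != set0 -> K \subset L ->
  edge_factor theta e (J :|: K) = edge_factor theta e (J :|: (K :&: block c)).
Proof.
move=> eF ec KL; have E := setI_block eF ec KL.
have E2 : e :\: (J :|: K) = e :\: (J :|: (K :&: block c)).
  apply/setP => u; have /setP /(_ u) := E.
  by rewrite !inE; case: (u \in e); rewrite ?andbF //= => <-.
by rewrite /edge_factor E2 -!setD_eq0 E2.
Qed.

Lemma setD_block c e K : e \in F -> v \in e -> e :&: block c != set0 ->
  K \subset L -> e :\: (v |: (J :|: K)) = e :\: (v |: (K :&: block c)).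
Proof.
move=> eF ve ec KL; have E := setI_block eF ec KL.
apply/setP => u; have /setP /(_ u) := E; rewrite !inE.
case uv: (u == v) => //=.
case ue: (u \in e); rewrite ?andbF //= => <-; rewrite !andbT.
have uL : u \in L by rewrite (subsetP (edge_link eF ve)) // !inE uv ue.
suff -> : u \in J = false by [].
by apply: contraTF uL => uJ; rewrite (disjointFr JL).
Qed.

Lemma gibbs_blocks K : K \subset L ->
  gibbs F theta lam (J :|: K) = outside_weight * \prod_c block_weight c (K :&: block c).
Proof.
move=> KL; rewrite /block_weight big_split /= prodrXr /gibbs /outside_weight.
have -> : (\sum_c #|K :&: block c| = #|K|)%N.
  rewrite -sum1_card (partition_big col predT) //=.
  apply: eq_bigr => c _; rewrite -sum1_card; apply: eq_bigl => u.
  rewrite !inE; case uK: (u \in K) => //=.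
  by have := subsetP KL _ uK; rewrite !inE => ->.
have JK0 : J :&: K = set0.
  by apply/eqP; rewrite setI_eq0; apply: disjointWr KL JL.
rewrite cardsU JK0 cards0 subn0 exprD -!mulrA; congr (_ * _).
rewrite mulrCA; congr (_ * _).
rewrite (bigID (fun e : {set V} => e :&: L == set0)) /=; congr (_ * _).
  apply: eq_bigr => e /andP [eF /eqP eL].
  have E : e :\: (J :|: K) = e :\: J.
    apply/setP => u; rewrite !inE; case uK: (u \in K); rewrite ?orbF //.
    have /setP /(_ u) := eL; rewrite !inE -in_setD1.
    have := subsetP KL _ uK; rewrite !inE => -> /=.
    by rewrite andbT => ->; rewrite !andbF.
  by rewrite /edge_factor -!setD_eq0 E.
rewrite -(big_blocks _ predT) /=.
apply: eq_bigr => c _; apply: eq_bigr => e /andP [eF ec].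
exact: edge_factor_block.
Qed.

Lemma threat_blocks K : K \subset L ->
  threat F theta v (J :|: K) = \sum_c block_threat c (K :&: block c).
Proof.
move=> KL; rewrite /threat.
transitivity (\sum_(e in F | (v \in e) && (e :&: L != set0))
    theta ^+ #|e :\: (v |: (J :|: K))|).
  apply: eq_bigl => e; case eF: (e \in F) => //=; case ve: (v \in e) => //=.
  by rewrite edge_meets_link.
rewrite -big_blocks; apply: eq_bigr => c _.
by apply: eq_bigr => e /and3P [eF ve ec]; rewrite (setD_block _ _ ec).
Qed.

Lemma keep_blocks K : K \subset L ->
  \prod_(e in F | v \in e) keep theta v e (J :|: K) =
  \prod_c block_keep c (K :&: block c).
Proof.
move=> KL.
transitivity (\prod_(e in F | (v \in e) && (e :&: L != set0))
    keep theta v e (J :|: K)).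
  apply: eq_bigl => e; case eF: (e \in F) => //=; case ve: (v \in e) => //=.
  by rewrite edge_meets_link.
rewrite -big_blocks; apply: eq_bigr => c _.
apply: eq_bigr => e /and3P [eF ve ec].
by rewrite /keep -!setD_eq0 (setD_block _ _ ec).
Qed.

Definition block_total c : R := \sum_(K : {set V} | K \subset block c) block_weight c K.
(** The mean threat to v from the edges in the block c, given the trace J of the
    random set outside the link and given that v is not chosen. *)
Definition block_mean_threat c : R :=
  (\sum_(K : {set V} | K \subset block c) block_weight c K * block_threat c K) / block_total c.

Lemma block_weight_ge0 c K : 0 <= block_weight c K.
Proof.
rewrite /block_weight mulr_ge0 ?exprn_ge0 ?(ltW lam0) // prodr_ge0 // => e _.
exact: edge_factor_ge0.
Qed.

Lemma block_threat_ge0 c K : 0 <= block_threat c K.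
Proof. by apply: sumr_ge0. Qed.

Lemma block_total_gt0 c : 0 < block_total c.
Proof.
rewrite /block_total (bigD1 set0) ?sub0set //=.
apply: ltr_wpDr; first by apply: sumr_ge0 => K _; exact: block_weight_ge0.
rewrite /block_weight cards0 expr0 mul1r; apply: prodr_gt0 => e /andP [eF].
move=> /set0Pn [u /setIP [ue /(subsetP (block_sub c)) uL]].
rewrite /edge_factor setU0 ifF ?expR_gt0 //; apply/negP => /subsetP /(_ _ ue) uJ.
by have := disjointFr JL uJ; rewrite uL.
Qed.

Lemma block_keep_ge c K : 1 - block_threat c K <= block_keep c K.
Proof.
apply: prod_ge_1Bsum => e _.
by split; [exact: keep_ge0|exact: thX|exact: keep_ge].
Qed.

(** Given everything else, a vertex is present with conditional weight at most
    lam; summing over the trace on e gives (theta + lam)^|e - v|, and e has at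
    least two vertices besides v. *)
Lemma block_edge_le c e : e \in F -> v \in e -> e :&: block c != set0 ->
  \sum_(K : {set V} | K \subset block c)
     block_weight c K * theta ^+ #|e :\: (v |: K)| <= (theta + lam) ^+ 2 * block_total c.
Proof.
move=> eF ve ec; set f := e :\ v.
have fB : f \subset block c.
  apply: subset_trans (edge_block eF ec); rewrite subsetI.
  by rewrite edge_link // subsetDl.
have fU : f :|: (block c :\: f) = block c.
  by rewrite -{2}(setID (block c) f) (setIidPr fB).
have fdis : [disjoint f & block c :\: f].
  by rewrite disjoint_sym disjoints_subset setDE subsetIr.
have f2 : (2 <= #|f|)%N.
  by have := Fcard eF; rewrite (cardsD1 v) ve.
have dec K1 K0 : K1 \subset f -> K0 \subset block c :\: f ->
    block_weight c (K1 :|: K0) <= lam ^+ #|K1| * block_weight c K0.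
  move=> s1 s0.
  rewrite /block_weight cardsU.
  have -> : K1 :&: K0 = set0.
    apply/eqP; rewrite setI_eq0; apply: disjointWl s1 _.
    exact: disjointWr s0 fdis.
  rewrite cards0 subn0 exprD -mulrA ler_wpM2l ?exprn_ge0 ?(ltW lam0) //.
  rewrite ler_wpM2l ?exprn_ge0 ?(ltW lam0) //.
  apply: ler_prod => e' _; rewrite edge_factor_ge0 /= edge_factor_anti //.
  by rewrite setUS // subsetUr.
rewrite -{1}fU (sum_subset_disjointU _ fdis).
apply: le_trans (_ : \sum_(K1 : {set V} | K1 \subset f)
   \sum_(K0 : {set V} | K0 \subset block c :\: f)
     lam ^+ #|K1| * theta ^+ #|f :\: K1| * block_weight c K0 <= _).
  apply: ler_sum => K1 s1; apply: ler_sum => K0 s0.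
  have -> : e :\: (v |: (K1 :|: K0)) = f :\: K1.
    rewrite /f -setDDl; apply/setP => u; rewrite !inE.
    case uK: (u \in K0); rewrite ?orbF //= orbT /=.
    have := subsetP s0 _ uK; rewrite !inE => /andP [/negPf].
    by move=> ->; rewrite andbF.
  by rewrite [leRHS]mulrAC ler_wpM2r // dec.
under eq_bigr => K1 _ do rewrite -mulr_sumr.
rewrite -mulr_suml sum_subset_binomial.
apply: ler_pM => //.
- by rewrite exprn_ge0 // addr_ge0 ?(ltW lam0) ?(ltW th0).
- by apply: sumr_ge0 => K _; exact: block_weight_ge0.
- rewrite addrC ler_wiXn2l // ?addr_ge0 ?(ltW lam0) ?(ltW th0) //.
  by case/andP: theta01 => _ h; case/andP: lam01 => _ h'; lra.
rewrite /block_total [leRHS](bigID (fun K : {set V} => K \subset block c :\: f)) /=.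
rewrite -[leLHS]addr0 lerD //; last first.
  by apply: sumr_ge0 => K _; exact: block_weight_ge0.
rewrite le_eqVlt; apply/orP; left; apply/eqP; apply: eq_bigl => K.
by case h: (K \subset _ :\: _); rewrite ?andbF // (subset_trans h) // subsetDl.
Qed.

Lemma block_mean_threat_ge0 c : 0 <= block_mean_threat c.
Proof.
rewrite divr_ge0 ?(ltW (block_total_gt0 c)) //.
by apply: sumr_ge0 => K _; rewrite mulr_ge0 ?block_weight_ge0 ?block_threat_ge0.
Qed.

Lemma block_mean_threat_le c : block_mean_threat c <= 2^-1.
Proof.
rewrite ler_pdivrMr ?block_total_gt0 // /block_threat.
under eq_bigr => K _ do rewrite mulr_sumr.
rewrite exchange_big /=.
apply: le_trans (_ : \sum_(e in F | (v \in e) && (e :&: block c != set0))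
    (theta + lam) ^+ 2 * block_total c <= _).
  by apply: ler_sum => e /and3P [eF ve ec]; exact: block_edge_le.
rewrite sumr_const -[leLHS]mulr_natl mulrA ler_wpM2r ?(ltW (block_total_gt0 c)) //.
apply: le_trans m_small; rewrite ler_wpM2r ?sqr_ge0 // ler_nat.
apply: leq_trans (blockP c); rewrite cardsE //.
Qed.

(** By independence of the blocks, the probability that v survives is a product
    over the blocks of factors at least 1 - y, with y <= 1/2 the mean threat of
    the block, and 1 - y >= exp (- 2 y). *)
Lemma sum_gibbs_keep_ge :
  outside_weight * \prod_c block_total c * expR (- (2 * \sum_c block_mean_threat c)) <=
  \sum_(K : {set V} | K \subset L)
     gibbs F theta lam (J :|: K) * \prod_(e in F | v \in e) keep theta v e (J :|: K).
Proof.
have -> : \sum_(K : {set V} | K \subset L)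
     gibbs F theta lam (J :|: K) * \prod_(e in F | v \in e) keep theta v e (J :|: K) =
    outside_weight * \prod_c \sum_(K : {set V} | K \subset block c)
       block_weight c K * block_keep c K.
  rewrite -(sum_subset_blocks L col (fun c K => block_weight c K * block_keep c K)).
  rewrite mulr_sumr; apply: eq_bigr => K KL.
  by rewrite gibbs_blocks // keep_blocks // -mulrA -big_split.
have w0 : 0 <= outside_weight.
  rewrite /outside_weight mulr_ge0 ?exprn_ge0 ?(ltW lam0) // prodr_ge0 // => e _.
  exact: edge_factor_ge0.
rewrite -mulrA ler_wpM2l // mulr_sumr -sumrN expR_sum -big_split /=.
apply: ler_prod => c _; have Z0 := block_total_gt0 c.
rewrite mulr_ge0 ?(ltW Z0) ?expR_ge0 //=.
apply: le_trans (_ : block_total c * (1 - block_mean_threat c) <= _).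
  by rewrite ler_wpM2l ?(ltW Z0) // expRN_double_le // block_mean_threat_ge0 block_mean_threat_le.
rewrite mulrBr mulr1 /block_mean_threat mulrCA divff ?gt_eqF // mulr1 /block_total -sumrB.
apply: ler_sum => K _; rewrite -[X in X - _]mulr1 -mulrBr.
by rewrite ler_wpM2l ?block_weight_ge0 // block_keep_ge.
Qed.

Lemma sum_gibbs_blocks :
  \sum_(K : {set V} | K \subset L) gibbs F theta lam (J :|: K) =
  outside_weight * \prod_c block_total c.
Proof.
rewrite /block_total -sum_subset_blocks mulr_sumr.
by apply: eq_bigr => K KL; rewrite gibbs_blocks.
Qed.

Lemma sum_gibbs_threat :
  \sum_(K : {set V} | K \subset L) gibbs F theta lam (J :|: K) * threat F theta v (J :|: K)
  = outside_weight * \prod_c block_total c * \sum_c block_mean_threat c.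
Proof.
transitivity (\sum_c0 \sum_(K : {set V} | K \subset L)
    outside_weight * \prod_c (block_weight c (K :&: block c) *
       (if c == c0 then block_threat c (K :&: block c) else 1))).
  rewrite exchange_big /=; apply: eq_bigr => K KL.
  rewrite gibbs_blocks // threat_blocks // mulr_sumr; apply: eq_bigr => c0 _.
  rewrite -mulrA; congr (_ * _); rewrite [RHS]big_split /=; congr (_ * _).
  by rewrite -big_mkcond big_pred1_eq.
rewrite mulr_sumr; apply: eq_bigr => c0 _.
rewrite -mulr_sumr -mulrA; congr (_ * _).
rewrite (sum_subset_blocks L col
   (fun c K => block_weight c K * (if c == c0 then block_threat c K else 1))).
rewrite (bigD1 c0) //= eqxx [in RHS](bigD1 c0) //= /block_mean_threat mulrAC.
congr (_ * _); first by rewrite mulrCA divff ?mulr1 // gt_eqF // block_total_gt0.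
apply: eq_bigr => c /negPf ->.
by apply: eq_bigr => K _; rewrite mulr1.
Qed.

End Outside.

(** The bound of sum_gibbs_keep_ge for each trace outside the link, averaged by
    Jensen's inequality. *)
Lemma inclusion_ge (W : {set V}) : v \in W -> L \subset W ->
  let P := \sum_(I : {set V} | I \subset W :\ v) gibbs F theta lam I in
  let Q := \sum_(I : {set V} | I \subset W :\ v)
             gibbs F theta lam I * threat F theta v I in
  0 < P ->
  lam * (P * expR (- (2 * (Q / P)))) <=
  \sum_(I : {set V} | (I \subset W) && (v \in I)) gibbs F theta lam I.
Proof.
move=> vW LW P Q P0.
have lam1 : 0 < lam <= 1 by case/andP: lam01 => -> h /=; lra.
rewrite sum_subset_with //.
have -> : \sum_(I : {set V} | I \subset W :\ v) gibbs F theta lam (v |: I) =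
    lam * \sum_(I : {set V} | I \subset W :\ v)
       gibbs F theta lam I * \prod_(e in F | v \in e) keep theta v e I.
  rewrite mulr_sumr; apply: eq_bigr => I; rewrite subsetD1 => /andP [_ vI].
  by rewrite gibbsU1 // mulrA.
rewrite ler_wpM2l ?(ltW lam0) //.
set R0 := (W :\ v) :\: L.
have WE : W :\ v = R0 :|: L.
  rewrite /R0 setUC -{1}(setID (W :\ v) L); congr (_ :|: _).
  by apply/setIidPr; rewrite subsetD1 LW notin_link.
have dR : [disjoint R0 & L] by rewrite disjoints_subset /R0 setDE subsetIr.
have out J : J \subset R0 -> [disjoint J & L] /\ v \notin J.
  move=> sJ; split; first exact: disjointWl sJ dR.
  by apply: contraTN isT => /(subsetP sJ); rewrite !inE eqxx andbF.
pose p J := outside_weight J * \prod_c block_total J c.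
pose x J := - (2 * \sum_c block_mean_threat J c).
have PE : P = \sum_(J : {set V} | J \subset R0) p J.
  rewrite /P WE (sum_subset_disjointU _ dR); apply: eq_bigr => J sJ.
  by have [JL vJ] := out J sJ; rewrite sum_gibbs_blocks.
have QE : - (2 * (Q / P)) = (\sum_(J : {set V} | J \subset R0) p J * x J) /
    \sum_(J : {set V} | J \subset R0) p J.
  rewrite -PE mulrA -mulNr; congr (_ / _).
  rewrite /Q WE (sum_subset_disjointU _ dR) mulr_sumr -sumrN.
  apply: eq_bigr => J sJ; have [JL vJ] := out J sJ.
  by rewrite sum_gibbs_threat // /x /p; ring.
rewrite QE PE.
apply: (le_trans (@Jensen_expR R _ (fun J : {set V} => J \subset R0) p x _ _)).
- move=> J sJ; have [JL vJ] := out J sJ; rewrite /p -sum_gibbs_blocks //.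
  by apply: sumr_ge0 => K _; exact: gibbs_ge0.
- by rewrite -PE.
rewrite WE (sum_subset_disjointU _ dR); apply: ler_sum => J sJ.
by have [JL vJ] := out J sJ; exact: sum_gibbs_keep_ge.
Qed.

End Local.

(** * Large independent sets from the Gibbs measure *)

Section Counting.
Variables (R : realType) (V : finType) (F : {set {set V}}) (theta lam : R).
Hypothesis theta01 : 0 < theta <= 2^-1.
Hypothesis lam01 : 0 < lam <= 2^-1.
Variables (W : {set V}) (k m : nat) (T : finType) (col : V -> V -> T).
Variables (M kappa alpha : R).
Hypothesis FW : forall e, e \in F -> e \subset W.
Hypothesis Fcard : forall e, e \in F -> (3 <= #|e| <= k)%N.
Hypothesis colP : forall v e u u', v \in W -> e \in F ->
  u \in e :&: link F v -> u' \in e :&: link F v -> col v u = col v u'.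
Hypothesis blockP : forall v c, v \in W ->
  (#|[set e in F | (v \in e) && (e :&: block F v (col v) c != set0)]| <= m)%N.
Hypothesis m_small : m%:R * (theta + lam) ^+ 2 <= 2^-1.
Hypothesis M0 : 0 <= M.
Hypothesis W0 : (0 < #|W|)%N.
Hypothesis alphaP : forall I : {set V}, I \subset W ->
  (forall e, e \in F -> ~~ (e \subset I)) -> #|I|%:R <= alpha.
Hypothesis sumF : \sum_(e in F) theta ^+ #|e| <= theta * (kappa * #|W|%:R).

Let th0 : 0 < theta. Proof. by case/andP: theta01. Qed.
Let lam0 : 0 < lam. Proof. by case/andP: lam01. Qed.
Let lam1 : 0 < lam <= 1. Proof. by case/andP: lam01 => -> h /=; lra. Qed.

Local Notation w := (gibbs F theta lam).
Local Notation y := (threat F theta).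
Local Notation N := (#|W|%:R : R).

Definition total : R := \sum_(I : {set V} | I \subset W) w I.
Definition total_without v : R := \sum_(I : {set V} | I \subset W :\ v) w I.
Definition threat_without v : R := \sum_(I : {set V} | I \subset W :\ v) w I * y v I.

Let N0 : 0 < N. Proof. by rewrite ltr0n. Qed.

Lemma w_ge0 I : 0 <= w I. Proof. exact: gibbs_ge0. Qed.

Lemma total_gt0 : 0 < total.
Proof.
rewrite /total (bigD1 set0) ?sub0set //=.
apply: ltr_wpDr; first by apply: sumr_ge0 => I _; exact: w_ge0.
rewrite /gibbs cards0 expr0 mul1r; apply: prodr_gt0 => e eF.
rewrite /edge_factor ifF ?expR_gt0 // subset0 -cards_eq0.
by have /andP [] := Fcard eF; case: #|e|.
Qed.

(** Adding v never increases the weight. *)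
Lemma total_without_ge v : v \in W -> total / 2 <= total_without v.
Proof.
move=> vW; have : total <= total_without v + total_without v; last by lra.
rewrite {1}/total (bigID (fun I : {set V} => v \in I)) /= lerD //.
  rewrite sum_subset_with //; apply: ler_sum => I.
  by rewrite subsetD1 => /andP [_ vI]; exact: gibbsU1_le.
rewrite le_eqVlt; apply/orP; left; apply/eqP.
by apply: eq_bigl => I; rewrite subsetD1.
Qed.

Lemma threat_without_ge0 v : 0 <= threat_without v.
Proof.
apply: sumr_ge0 => I _; rewrite mulr_ge0 ?w_ge0 //; exact: threat_ge0.
Qed.

Lemma occupation_ge v : v \in W ->
  lam * (total / 2) * expR (- (4 * (threat_without v / total))) <=
  \sum_(I : {set V} | (I \subset W) && (v \in I)) w I.
Proof.
move=> vW; have Z0 := total_gt0; have Zo := total_without_ge vW.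
have Zo0 : 0 < total_without v by lra.
have LW : link F v \subset W.
  apply/subsetP => u /setD1P [_ /bigcupP [e /andP [eF _] ue]].
  exact: subsetP (FW eF) _ ue.
have Fc e : e \in F -> (3 <= #|e|)%N by move=> /Fcard /andP [].
have cP e u u' := @colP v e u u' vW.
have bP c := blockP c vW.
apply: le_trans (inclusion_ge theta01 lam01 Fc cP bP m_small vW LW Zo0).
rewrite -mulrA ler_wpM2l ?(ltW lam0) //.
  apply: ler_pM => //; rewrite ?expR_ge0 ?divr_ge0 ?(ltW Z0) //.
  rewrite ler_expR lerN2 -[4]/(2 * 2)%:R natrM -mulrA ler_wpM2l //.
  rewrite ler_pdivrMr //.
  have -> : 2 * (threat_without v / total) * total_without v = threat_without v * (2 * total_without v / total) by ring.
  by rewrite ler_peMr ?threat_without_ge0 // ler_pdivlMr // mul1r; lra.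

Qed.

Lemma sum_card_le :
  \sum_(I : {set V} | I \subset W) w I * #|I|%:R <= alpha * total.
Proof.
rewrite mulrC /total mulr_suml; apply: ler_sum => I IW.
have [->|wI] := eqVneq (w I) 0; first by rewrite !mul0r.
by rewrite ler_wpM2l ?w_ge0 // alphaP //; exact: gibbs_neq0_indep wI.
Qed.

Lemma sum_inside_le :
  \sum_(I : {set V} | I \subset W) w I * \sum_(v in I) y v I <=
  (M * alpha + 4 * lam * expR (- (M / 4)) * N) * total.
Proof.
pose C := 4 * lam * expR (- (M / 4)).
have C0 : 0 <= C by rewrite mulr_ge0 ?expR_ge0 // mulr_ge0 // (ltW lam0).
apply: le_trans (_ : \sum_(I : {set V} | I \subset W)
    (M * (w I * #|I|%:R) + C * \sum_(v in I) w (I :\ v)) <= _).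
  apply: ler_sum => I IW; rewrite mulr_sumr.
  apply: le_trans (_ : \sum_(v in I) (M * w I + C * w (I :\ v)) <= _).
    by apply: ler_sum => v vI; exact: gibbs_threat_le.
  rewrite big_split /= sumr_const -mulr_sumr -[X in X + _]mulr_natr.
  by rewrite mulrA.
rewrite big_split /= -!mulr_sumr mulrDl lerD //.
  by rewrite -mulrA ler_wpM2l // sum_card_le.
rewrite -[leRHS]mulrA ler_wpM2l //.
rewrite (exchange_big_dep (fun v => v \in W)) /=; last first.
  by move=> I v IW vI; exact: subsetP IW _ vI.
rewrite mulr_natl -sumr_const; apply: ler_sum => v vW.
rewrite sum_subset_with // /total.
rewrite [leRHS](bigID (fun I : {set V} => v \notin I)) /= -[leLHS]addr0.
apply: lerD; last by apply: sumr_ge0 => I _; exact: w_ge0.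
rewrite le_eqVlt; apply/orP; left; apply/eqP.
apply: eq_big => [I|I]; first by rewrite subsetD1.
by rewrite subsetD1 => /andP [_ vI]; rewrite setU1K.
Qed.

Lemma sum_threat_without_le :
  \sum_(v in W) threat_without v <=
  (k%:R / theta * (M * (alpha / N) + 4 * lam * expR (- (M / 4))) + k%:R * kappa)
    * N * total.
Proof.
have kt0 : 0 <= k%:R / theta by rewrite divr_ge0 // (ltW th0).
have -> : \sum_(v in W) threat_without v =
   \sum_(I : {set V} | I \subset W) w I * \sum_(v in W :\: I) y v I.
  rewrite /threat_without (exchange_big_dep (fun I : {set V} => I \subset W)) /=.
    apply: eq_bigr => I IW; rewrite mulr_sumr; apply: eq_bigl => v.
    by rewrite subsetD1 IW /= inE andbC.
  by move=> v I _; rewrite subsetD1 => /andP [].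
apply: le_trans (_ : \sum_(I : {set V} | I \subset W)
   (k%:R / theta * (w I * \sum_(v in I) y v I) +
    k%:R / theta * (\sum_(e in F) theta ^+ #|e|) * w I) <= _).
  apply: ler_sum => I IW; rewrite [X in _ + X]mulrC mulrCA -mulrDr -mulrDr.
  rewrite ler_wpM2l ?w_ge0 // sum_threat_outside_le // => e eF.
  by have /andP [] := Fcard eF.
rewrite big_split /= -!mulr_sumr.
have S1 := sum_inside_le.
have Z0 := total_gt0.
have -> : (k%:R / theta * (M * (alpha / N) + 4 * lam * expR (- (M / 4)))
   + k%:R * kappa) * N * total =
   k%:R / theta * ((M * alpha + 4 * lam * expR (- (M / 4)) * N) * total) +
   k%:R / theta * (theta * (kappa * N)) * total.
  by field; rewrite !gt_eqF.
apply: lerD; first by rewrite ler_wpM2l.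
by rewrite ler_wpM2r ?(ltW Z0) // ler_wpM2l.
Qed.

(** The average occupation is at most alpha / N.  It is bounded below by the
    exponential of minus the average threat (occupation_ge and Jensen's
    inequality over the vertices), which in turn is bounded above in terms of
    alpha (sum_threat_without_le). *)
Lemma independent_set_bound :
  lam / 2 * N *
  expR (- (4 * (k%:R / theta * (M * (alpha / N) + 4 * lam * expR (- (M / 4)))
                + k%:R * kappa))) <= alpha.
Proof.
set q := _ + k%:R * kappa.
have Z0 := total_gt0.
have h1 : \sum_(v in W) lam * (total / 2) * expR (- (4 * (threat_without v / total))) <=
    alpha * total.
  apply: le_trans sum_card_le.
  apply: le_trans (_ : \sum_(v in W) \sum_(I : {set V} | (I \subset W) && (v \in I)) w I <= _).
    by apply: ler_sum => v vW; exact: occupation_ge.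
  rewrite (exchange_big_dep (fun I : {set V} => I \subset W)) /=; last first.
    by move=> v I _ /andP [].
  apply: ler_sum => I IW; rewrite mulr_natr -sumr_const.
  rewrite le_eqVlt; apply/orP; left; apply/eqP.
  apply: eq_bigl => v; rewrite IW /=; case vI: (v \in I); rewrite ?andbF //.
  by rewrite (subsetP IW _ vI).
have S1 : \sum_(v in W) (1 : R) = N by rewrite sumr_const.
have h2 := @Jensen_expR R _ (fun v => v \in W) (fun=> 1)
  (fun v => - (4 * (threat_without v / total))) (fun _ _ => ler01).
rewrite S1 in h2; have {}h2 := h2 N0.
rewrite -mulr_sumr in h1.
have h3 : expR (- (4 * q)) <= expR ((\sum_(v in W) 1 * - (4 * (threat_without v / total))) / N).
  rewrite ler_expR.
  have -> : \sum_(v in W) 1 * - (4 * (threat_without v / total)) =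
      - (4 * ((\sum_(v in W) threat_without v) / total)).
    under eq_bigr => v _ do rewrite mul1r.
    by rewrite sumrN -mulr_sumr -mulr_suml.
  rewrite mulNr lerN2 -mulrA ler_wpM2l // ler_pdivrMr // ler_pdivrMr //.
  exact: sum_threat_without_le.
have h4 : N * expR (- (4 * q)) <= \sum_(v in W) expR (- (4 * (threat_without v / total))).
  apply: le_trans (le_trans h2 _); first by rewrite ler_wpM2l // ltW.
  by apply: ler_sum => v _; rewrite mul1r.
have h5 : lam * (total / 2) * (N * expR (- (4 * q))) <= alpha * total.
  apply: le_trans h1; rewrite ler_wpM2l //.
  by rewrite mulr_ge0 ?(ltW lam0) // divr_ge0 // ltW.
rewrite -(ler_pM2r Z0); apply: le_trans h5.
by rewrite le_eqVlt; apply/orP; left; apply/eqP; field.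
Qed.

End Counting.

(** * Clusters of overlapping edges *)

Section Clusters.
Variables (V : finType) (F : {set {set V}}) (r tau : nat).
Implicit Types (e g : {set V}) (u v : V).

Definition bad_pair g g' : bool :=
  (g != g') && (2 <= #|g :&: g'| < r)%N.

(** A triangle in which g meets each of the two other edges in one vertex only. *)
Definition bad_triple g g1 g3 : bool :=
  [&& #|g :&: g1| == 1%N, #|g :&: g3| == 1%N, g :&: g1 :&: g3 == set0
    & g1 :&: g3 != set0].

Hypothesis r3 : (3 <= r)%N.
Hypothesis Fsize : forall e, e \in F -> (r <= #|e| <= r.+1)%N.
Hypothesis Fanti : forall e g, e \in F -> g \in F -> e \subset g -> e = g.
Hypothesis no_bad_pair : forall e g, e \in F -> g \in F -> ~~ bad_pair e g.
Hypothesis no_bad_triple : forall g g1 g3, g \in F -> g1 \in F -> g3 \in F ->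
  ~~ bad_triple g g1 g3.

Definition near g g' : bool := (2 <= #|g :&: g'|)%N.

Lemma near_sym g g' : near g g' = near g' g.
Proof. by rewrite /near setIC. Qed.

Lemma near_refl g : g \in F -> near g g.
Proof. by move=> /Fsize; rewrite /near setIid; lia. Qed.

(** Two edges sharing two vertices share r of them, since smaller intersections
    are bad; an edge of size r would then be contained in the other one. *)
Lemma near_card g g' : g \in F -> g' \in F -> g != g' -> near g g' ->
  [/\ #|g| = r.+1, #|g'| = r.+1 & #|g :&: g'| = r].
Proof.
move=> gF g'F gg' n; have := no_bad_pair gF g'F; rewrite /bad_pair gg' /= => c.
rewrite /near in n.
have s1 := Fsize gF; have s2 := Fsize g'F.
have i1 := subset_leq_card (subsetIl g g').
have i2 := subset_leq_card (subsetIr g g').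
have h1 : #|g :&: g'| <> #|g|.
  move=> h; move/eqP: gg'; apply; apply: Fanti => //; apply/setIidPl/eqP.
  by rewrite eqEcard subsetIl h /=.
have h2 : #|g :&: g'| <> #|g'|.
  move=> h; move/eqP: gg'; apply; apply/esym; apply: Fanti => //.
  by apply/setIidPr/eqP; rewrite eqEcard subsetIr h /=.
by split; lia.
Qed.

(** Inside an edge of size r + 1, two intersections of size r share at least
    r - 1 >= 2 vertices. *)
Lemma near_trans g1 g2 g3 : g1 \in F -> g2 \in F -> g3 \in F ->
  near g1 g2 -> near g2 g3 -> near g1 g3.
Proof.
move=> F1 F2 F3 n12 n23.
have [<-//|ne12] := eqVneq g2 g1.
have [<-//|ne23] := eqVneq g2 g3; rewrite eq_sym in ne12.
have [_ c2 c12] := near_card F1 F2 ne12 n12.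
have [_ _ c23] := near_card F2 F3 ne23 n23.
have := cardsUI (g1 :&: g2) (g2 :&: g3).
have := subset_leq_card (_ : (g1 :&: g2) :|: (g2 :&: g3) \subset g2).
rewrite subUset subsetIr subsetIl => /(_ isT).
have := subset_leq_card (_ : (g1 :&: g2) :&: (g2 :&: g3) \subset g1 :&: g3).
have -> : (g1 :&: g2) :&: (g2 :&: g3) \subset g1 :&: g3.
  by apply/subsetP => u; rewrite !inE => /andP [/andP [-> _] /andP [_ ->]].
by move=> /(_ isT); rewrite /near; lia.
Qed.

Lemma near2 g g' u v : u != v -> u \in g -> v \in g -> u \in g' -> v \in g' ->
  near g g'.
Proof.
move=> uv ug vg ug' vg'; rewrite /near.
have <- : #|[set u; v]| = 2%N by rewrite cards2 uv.
by apply: subset_leq_card; rewrite subUset !sub1set !inE ug vg ug' vg'.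
Qed.

(** The class of the edges through v and u, restricted to the edges at v; defined
    without choosing such an edge. *)
Definition cluster v u : {set {set V}} :=
  [set g in F | (v \in g) &&
     [exists g0 in F, [&& v \in g0, u \in g0 & near g g0]]].

Lemma clusterE v u e : e \in F -> v \in e -> u \in e -> u != v ->
  cluster v u = [set g in F | (v \in g) && near g e].
Proof.
move=> eF ve ue uv; apply/setP => g; rewrite !inE.
case gF: (g \in F) => //=; case vg: (v \in g) => //=.
apply/'exists_and3P/idP => [[g0 [g0F vg0 /andP [ug0 n]]]|n].
  by apply: (near_trans gF g0F eF n); apply: (near2 uv).
by exists e; rewrite ve ue n.
Qed.

(** An edge e that avoids v but meets two edges g, g' at v forms a triangle with
    them.  If g and g' are not near, then one of them, g say, is not near e, and
    it meets both e and g' in one vertex: a bad triple. *)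
Lemma cluster_edge v e u u' : e \in F ->
  u \in e :&: link F v -> u' \in e :&: link F v -> cluster v u = cluster v u'.
Proof.
have linkP w : w \in link F v -> w != v /\ exists2 g, g \in F & (v \in g) && (w \in g).
  move=> /setD1P [wv /bigcupP [g /andP [gF vg] wg]].
  by split=> //; exists g => //; rewrite vg wg.
move=> eF /setIP [ue /linkP [uv [g gF /andP [vg ug]]]].
move=> /setIP [u'e /linkP [u'v [g' g'F /andP [vg' u'g']]]].
have [ve|ve] := boolP (v \in e).
  by rewrite !(clusterE eF ve).
suff n : near g g'.
  rewrite (clusterE gF vg) // (clusterE g'F vg') //.
  apply/setP => h; rewrite !inE; case hF: (h \in F) => //=.
  congr (_ && _); apply/idP/idP => n'; first exact: near_trans n' n.
  by apply: near_trans n' _; rewrite // near_sym.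
apply: contraT => n.
have one x y w : x \in F -> y \in F -> w \in x -> w \in y -> ~~ near x y ->
    #|x :&: y| = 1%N.
  move=> xF yF wx wy; rewrite /near -ltnNge => h.
  have h0 : (0 < #|x :&: y|)%N by apply/card_gt0P; exists w; rewrite inE wx.
  by apply/eqP; rewrite eqn_leq h0 andbT.
have gg' := one _ _ _ gF g'F vg vg' n.
have gg'E : g :&: g' = [set v].
  apply/esym/eqP; rewrite eqEcard sub1set inE vg vg' /= cards1 gg' //.
have e0 : e :&: [set v] = set0.
  by apply/setP => x; rewrite !inE; case: eqP => [->|]; rewrite ?(negPf ve) ?andbF.
have [neg|neg] := boolP (near e g).
  (* If g is near e, then g' is not, and g' is the edge with two single meetings. *)
  have neg' : ~~ near g' e.
    apply: contra n => n'; apply: (near_trans gF eF g'F); rewrite near_sym //.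
  have gg's : #|g' :&: g| = 1%N by rewrite setIC.
  have i0 : g' :&: e :&: g = set0 by rewrite setIAC [g' :&: g]setIC gg'E setIC e0.
  have eg : e :&: g != set0 by apply/set0Pn; exists u; rewrite inE ue.
  have := no_bad_triple g'F eF gF.
  by rewrite /bad_triple (one _ _ u' g'F eF u'g' u'e neg') gg's i0 eg !eqxx.
have neg' : ~~ near g e by rewrite near_sym.
have i0 : g :&: e :&: g' = set0 by rewrite setIAC gg'E setIC e0.
have eg : e :&: g' != set0 by apply/set0Pn; exists u'; rewrite inE u'e.
have := no_bad_triple gF eF g'F.
by rewrite /bad_triple (one _ _ u gF eF ug ue neg') gg' i0 eg !eqxx.
Qed.

Hypothesis tau0 : (0 < tau)%N.
Hypothesis small_stars : forall A : {set V}, #|A| = r ->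
  (#|[set e in F | (A \subset e) && (#|e| == r.+1)]| <= tau)%N.

(** If e has size r + 1, every member of its class contains one of the r + 1
    subsets of e of size r; if e has size r, it is alone in its class. *)
Lemma near_class_card e : e \in F -> (#|[set g in F | near g e]| <= r.+1 * tau)%N.
Proof.
move=> eF; have [er|er] := eqVneq #|e| r.+1; last first.
  apply: leq_trans (_ : 1 <= _)%N; last by rewrite muln_gt0.
  rewrite -(cards1 e); apply: subset_leq_card; apply/subsetP => g.
  rewrite !inE => /andP [gF n]; apply: contraT => ge.
  by have [_ h _] := near_card gF eF ge n; rewrite h eqxx in er.
apply: leq_trans (_ : #|\bigcup_(u in e)
    [set g in F | (e :\ u \subset g) && (#|g| == r.+1)]| <= _)%N.
  apply: subset_leq_card; apply/subsetP => g; rewrite inE => /andP [gF n].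
  have [->|ge] := eqVneq g e.
    have /card_gt0P [u ue] : (0 < #|e|)%N by rewrite er.
    by apply/bigcupP; exists u => //; rewrite inE eF subsetDl er eqxx.
  have [c1 c2 c3] := near_card gF eF ge n.
  have : #|e :\: g| = 1%N.
    by have := cardsID g e; rewrite setIC c3 c2; lia.
  move=> /eqP /cards1P [u uE]; apply/bigcupP; exists u.
    by have : u \in e :\: g by [rewrite uE set11]; case/setDP.
  rewrite inE gF c1 eqxx andbT /=; apply/subsetP => x /setD1P [xu xe].
  apply: contraR xu => xg; rewrite -in_set1 -uE inE xg //.
have -> : (r.+1 * tau = \sum_(u in e) tau)%N by rewrite sum_nat_const er.
apply: leq_trans (_ : \sum_(u in e)
    #|[set g in F | (e :\ u \subset g) && (#|g| == r.+1)]| <= _)%N.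
  apply: (big_ind2 (fun (A : {set {set V}}) n => #|A| <= n)%N) => //.
    by rewrite cards0.
  move=> A1 n1 A2 n2 h1 h2; apply: leq_trans (leq_card_setU _ _) _.
  exact: leq_add.
apply: leq_sum => u ue; apply: small_stars.
by have := cardsD1 u e; rewrite ue er; lia.
Qed.

Lemma cluster_block v (c : {set {set V}}) :
  (#|[set e in F | (v \in e) &&
      (e :&: block F v (cluster v) c != set0)]| <= r.+1 * tau)%N.
Proof.
set B := [set e in F | _]; have [->|/set0Pn [e0]] := eqVneq B set0.
  by rewrite cards0.
have inB e : e \in B -> [/\ e \in F, v \in e &
    exists u, [/\ u \in e, u != v & cluster v u = c]].
  rewrite inE => /and3P [eF ve /set0Pn [u /setIP [ue]]].
  rewrite inE => /andP [/setD1P [uv _] /eqP cE].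
  by split=> //; exists u.
move=> /inB [e0F ve0 [u0 [u0e0 u0v c0]]].
apply: leq_trans (near_class_card e0F); apply: subset_leq_card.
apply/subsetP => e /inB [eF ve [u [ue uv cE]]]; rewrite inE eF /=.
have : e \in cluster v u by rewrite (clusterE eF ve) // inE eF ve near_refl.
by rewrite cE -c0 (clusterE e0F ve0) // inE => /and3P [].
Qed.

End Clusters.

(** * Cleaning a hypergraph by random sampling *)

Section RandomSubset.
Variables (R : realFieldType) (V : finType) (p : R).
Hypothesis p01 : 0 <= p <= 1.
Implicit Types (A B S Q : {set V}).

Definition prob S : R := \prod_u (if u \in S then p else 1 - p).
Definition mean (h : {set V} -> R) : R := \sum_S prob S * h S.

Lemma prob_ge0 S : 0 <= prob S.
Proof.
by apply: prodr_ge0 => u _; case: ifP => _; case/andP: p01 => ? ?; lra.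
Qed.

(** The generating function of a binomial variable, jointly with an independent
    event; c = 1 gives probabilities, and c = 2 gives the exponential moment
    used for large deviations. *)
Lemma mean_pgf A B (c : R) : [disjoint A & B] ->
  mean (fun S => (A \subset S)%:R * c ^+ #|B :&: S|) =
  p ^+ #|A| * (1 - p + p * c) ^+ #|B|.
Proof.
move=> dAB.
have -> : p ^+ #|A| * (1 - p + p * c) ^+ #|B| =
    \prod_u ((if u \in B then p * c else p) +
             (if u \in A then 0 else 1 - p)).
  rewrite -!prodr_const (big_mkcond (fun u => u \in A)).
  rewrite (big_mkcond (fun u => u \in B)) -big_split /=.
  apply: eq_bigr => u _; case uA: (u \in A).
    by rewrite (disjointFr dAB uA) mulr1 addr0.
  by case: ifP => _; rewrite mul1r; ring.
rewrite bigA_distr /mean; apply: eq_big => // S _.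
have -> : (A \subset S)%:R = \prod_u (if u \in A then (u \in S)%:R else 1) :> R.
  rewrite -big_mkcond /=; case: (boolP (A \subset S)) => [AS|/subsetPn [u uA uS]].
    by rewrite big1 // => u uA; rewrite (subsetP AS).
  by rewrite (bigD1 u) //= (negPf uS) mul0r.
have -> : c ^+ #|B :&: S| = \prod_u (if u \in B :&: S then c else 1).
  by rewrite -big_mkcond prodr_const.
rewrite /prob -!big_split /=; apply: eq_bigr => u _; rewrite inE.
by case: (u \in S); case uA: (u \in A); case uB: (u \in B) => /=;
  rewrite ?(mulr1, mul1r, mulr0, mul0r) // -(disjointFr dAB uA).
Qed.

Lemma mean_subset Q : mean (fun S => (Q \subset S)%:R) = p ^+ #|Q|.
Proof.
have := @mean_pgf Q set0 1; rewrite disjoints_subset setC0 subsetT cards0 expr0 mulr1.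
move=> <- //; apply: eq_bigr => S _.
by rewrite expr1n mulr1.
Qed.

Lemma mean1 : mean (fun=> 1) = 1.
Proof.
rewrite -[RHS](expr0 p) -(cards0 V) -mean_subset.
by apply: eq_bigr => S _; rewrite sub0set.
Qed.

Lemma mean_sum (I : finType) (P : pred I) (h : I -> {set V} -> R) :
  mean (fun S => \sum_(i | P i) h i S) = \sum_(i | P i) mean (h i).
Proof.
rewrite /mean exchange_big /=; apply: eq_bigr => S _.
by rewrite mulr_sumr.
Qed.

Lemma mean_card : mean (fun S => #|S|%:R) = p * #|V|%:R.
Proof.
have -> : p * #|V|%:R = \sum_(u : V) mean (fun S => ([set u] \subset S)%:R).
  under eq_bigr => u _ do rewrite mean_subset cards1 expr1.
  by rewrite sumr_const mulr_natr.
rewrite -mean_sum; apply: eq_bigr => S _; congr (_ * _).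
rewrite -sum1_card natr_sum big_mkcond /=; apply: eq_bigr => u _.
by rewrite sub1set; case: ifP.
Qed.

Lemma meanB f g : mean (fun S => f S - g S) = mean f - mean g.
Proof. by rewrite -sumrB; apply: eq_bigr => S _; rewrite mulrBr. Qed.

Lemma meanZ a f : mean (fun S => a * f S) = a * mean f.
Proof. by rewrite mulr_sumr; apply: eq_bigr => S _; rewrite mulrCA. Qed.

Lemma le_mean f g : (forall S, f S <= g S) -> mean f <= mean g.
Proof.
by move=> fg; apply: ler_sum => S _; rewrite ler_wpM2l ?prob_ge0.
Qed.

Lemma exists_ge_mean f (a : R) : a <= mean f -> exists S, a <= f S.
Proof.
move=> h; apply/existsP; apply: contraT; rewrite negb_exists => /forallP H.
have lt S : f S < a by rewrite ltNge.
have E : \sum_S prob S * (a - f S) <= 0.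
  under eq_bigr => S _ do rewrite mulrBr.
  rewrite sumrB -mulr_suml.
  have -> : \sum_S prob S = 1.
    by rewrite -mean1; apply: eq_bigr => S _; rewrite mulr1.
  by rewrite mul1r subr_le0.
have P0 S : prob S = 0.
  have ge0 S' : 0 <= prob S' * (a - f S').
    by rewrite mulr_ge0 ?prob_ge0 // subr_ge0 ltW.
  have : prob S * (a - f S) <= 0.
    apply: le_trans E; rewrite (bigD1 S) //= lerDl.
    by apply: sumr_ge0.
  rewrite pmulr_lle0 ?subr_gt0 // => h0.
  by apply/eqP; rewrite eq_le h0 prob_ge0.
have := mean1; rewrite /mean big1; last by move=> S _; rewrite P0 mul0r.
by move=> /esym/eqP; rewrite oner_eq0.
Qed.

End RandomSubset.

Lemma exists_hitting_deletion (V I : finType) (B : {set I}) (q : I -> {set V}) (S : {set V}) :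
  (forall i, i \in B -> q i != set0) ->
  exists W : {set V}, [/\ W \subset S, (#|S| <= #|W| + #|B|)%N &
    forall i, i \in B -> ~~ (q i \subset W)].
Proof.
move=> qB.
pose pk i := [set u | Some u == [pick u in q i]].
pose X := \bigcup_(i in B) pk i.
have cX : (#|X| <= #|B|)%N.
  have -> : #|B| = (\sum_(i in B) 1)%N by rewrite sum1_card.
  rewrite /X; apply: (big_ind2 (fun (A : {set V}) n => #|A| <= n)%N) => //.
  - by rewrite cards0.
  - move=> A1 n1 A2 n2 h1 h2; apply: leq_trans (leq_card_setU _ _) _.
    exact: leq_add.
  - move=> i _; rewrite /pk; case: pickP => [u _|_].
      rewrite -(cards1 u); apply: subset_leq_card; apply/subsetP => w.
      by rewrite !inE => /eqP [->].
    by rewrite (_ : [set _ | _] = set0) ?cards0 //; apply/setP => w; rewrite !inE.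
exists (S :\: X); split; first exact: subsetDl.
  have := cardsID X S; have := subset_leq_card (subsetIr S X); lia.
move=> i iB; have := qB i iB; case/set0Pn => u0 u0q.
apply/subsetPn; have := erefl [pick u in q i].
case: {2}[pick u in q i]/pickP => [u uq E|/(_ u0)]; last by rewrite u0q.
exists u => //; rewrite inE negb_and negbK; apply/orP; left.
by apply/bigcupP; exists i => //; rewrite inE E.
Qed.

Section Cleaning.
Variables (R : realType) (V : finType) (G : {set {set V}}) (r tau : nat).
Variables (p t C : R).
Hypothesis p01 : 0 < p <= 1.
Hypothesis t1 : 1 <= t.
Hypothesis C0 : 0 < C.
Hypothesis r3 : (3 <= r)%N.
Hypothesis Gsize : forall e, e \in G -> (r <= #|e| <= r.+1)%N.

Definition extensions (A : {set V}) : {set V} :=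
  [set x | (x \notin A) && (x |: A \in G)].

Local Notation pn := (p * #|V|%:R).

Hypothesis few_pairs :
  \sum_(q : {set V} * {set V} | [&& q.1 \in G, q.2 \in G & bad_pair r q.1 q.2])
    p ^+ #|q.1 :|: q.2| <= pn / 16.
Hypothesis few_triples :
  \sum_(q : {set V} * {set V} * {set V} |
      [&& q.1.1 \in G, q.1.2 \in G, q.2 \in G & bad_triple q.1.1 q.1.2 q.2])
    p ^+ #|q.1.1 :|: q.1.2 :|: q.2| <= pn / 16.
Hypothesis few_stars :
  \sum_(A : {set V} | #|A| == r) p ^+ r * (1 + p) ^+ #|extensions A| / 2 ^+ tau
    <= pn / 16.
Hypothesis few_edges :
  \sum_(g in G) (p / t) ^+ #|g| <= C * pn / t.

(** First moment method: with t / (4 C) times the weighted edge count subtracted,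
    the size of the sample minus the number of its bad configurations has mean
    at least half of the mean size.  One vertex is then deleted from every bad
    configuration. *)
Lemma exists_clean_subset :
  exists W : {set V}, let F := [set g in G | g \subset W] in
  [/\ pn / 2 <= #|W|%:R,
      forall e g, e \in F -> g \in F -> ~~ bad_pair r e g,
      forall g g1 g3, g \in F -> g1 \in F -> g3 \in F -> ~~ bad_triple g g1 g3,
      forall A : {set V}, #|A| = r ->
        (#|[set e in F | (A \subset e) && (#|e| == r.+1)]| <= tau)%N &
      \sum_(e in F) t^-1 ^+ #|e| <= 4 * C * #|W|%:R / t].
Proof.
have t0 : 0 < t by exact: lt_le_trans ltr01 t1.
have p01' : 0 <= p <= 1 by case/andP: p01 => h1 h2; rewrite ltW.
have p0 : 0 < p by case/andP: p01.
pose P1 (q : {set V} * {set V}) := [&& q.1 \in G, q.2 \in G & bad_pair r q.1 q.2].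
pose P2 (q : {set V} * {set V} * {set V}) :=
  [&& q.1.1 \in G, q.1.2 \in G, q.2 \in G & bad_triple q.1.1 q.1.2 q.2].
pose b1 (S : {set V}) : R := \sum_(q | P1 q) (q.1 :|: q.2 \subset S)%:R.
pose b2 (S : {set V}) : R := \sum_(q | P2 q) (q.1.1 :|: q.1.2 :|: q.2 \subset S)%:R.
pose b3 (S : {set V}) : R := \sum_(A : {set V} | #|A| == r)
   ((A \subset S) && (tau <= #|extensions A :&: S|)%N)%:R.
pose b4 (S : {set V}) : R := \sum_(g in G) t^-1 ^+ #|g| * (g \subset S)%:R.
(* The weight t / (4 C) makes the mean of the last term at most a quarter of the
   mean size. *)
pose Phi (S : {set V}) : R := #|S|%:R - b1 S - b2 S - b3 S - t / (4 * C) * b4 S.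
have m1 : mean p b1 <= pn / 16.
  rewrite /b1 mean_sum; apply: le_trans few_pairs; apply: ler_sum => q _.
  by rewrite mean_subset.
have m2 : mean p b2 <= pn / 16.
  rewrite /b2 mean_sum; apply: le_trans few_triples; apply: ler_sum => q _.
  by rewrite mean_subset.
have m3 : mean p b3 <= pn / 16.
  rewrite /b3 mean_sum; apply: le_trans few_stars; apply: ler_sum => A /eqP Ar.
  have dis : [disjoint A & extensions A].
    by rewrite disjoint_sym disjoints_subset; apply/subsetP => x; rewrite !inE => /andP [].
  have -> : p ^+ r * (1 + p) ^+ #|extensions A| / 2 ^+ tau =
     mean p (fun S => (2 ^+ tau)^-1 * ((A \subset S)%:R * 2 ^+ #|extensions A :&: S|)).
    rewrite meanZ mean_pgf // Ar mulrC; congr (_ * (_ * _ ^+ _)); ring.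
  apply: le_mean => // S; case: (A \subset S) => /=; last first.
    by rewrite mul0r mulr0.
  rewrite mul1r; case: leqP => h; last by rewrite mulr_ge0 ?invr_ge0 ?exprn_ge0.
  by rewrite mulrC ler_pdivlMr ?exprn_gt0 // mul1r ler_eXn2l // ltr1n.
have m4 : mean p b4 <= C * pn / t.
  rewrite /b4 mean_sum; apply: le_trans few_edges; apply: ler_sum => g _.
  by rewrite meanZ mean_subset expr_div_n exprVn mulrC.
have pn0 : 0 <= pn by rewrite mulr_ge0 ?(ltW p0).
have mP : pn / 2 <= mean p Phi.
  rewrite /Phi !meanB meanZ mean_card.
  have : t / (4 * C) * mean p b4 <= pn / 4.
    apply: le_trans (_ : t / (4 * C) * (C * pn / t) <= _).
      by rewrite ler_wpM2l // divr_ge0 ?mulr_ge0 ?(ltW t0) ?(ltW C0).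
    by rewrite le_eqVlt; apply/orP; left; apply/eqP; field; rewrite !gt_eqF.
  by move=> h; clear -h m1 m2 m3 pn0; lra.
have [S PS] := exists_ge_mean p01' mP.
pose B1 := [set q | P1 q && (q.1 :|: q.2 \subset S)].
pose B2 := [set q | P2 q && (q.1.1 :|: q.1.2 :|: q.2 \subset S)].
pose B3 := [set A : {set V} | (#|A| == r) &&
   ((A \subset S) && (tau <= #|extensions A :&: S|)%N)].
have cardB (I : finType) (P Q : pred I) :
    \sum_(i | P i) (Q i)%:R = #|[set i | P i && Q i]|%:R :> R.
  rewrite -sum1_card natr_sum.
  rewrite [RHS](eq_bigl (fun i => P i && Q i)); last by move=> i; rewrite inE.
  rewrite big_mkcondr /=; apply: eq_bigr => i _; by case: (Q i).
have Gn0 e : e \in G -> e != set0.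
  move=> /Gsize /andP [h _]; rewrite -card_gt0.
  by apply: leq_trans h; exact: leq_trans r3.
have [W1 [W1S c1 d1]] : exists W : {set V}, [/\ W \subset S, (#|S| <= #|W| + #|B1|)%N &
    forall i, i \in B1 -> ~~ (i.1 :|: i.2 \subset W)].
  apply: exists_hitting_deletion => q; rewrite inE => /andP [/and3P [/Gn0 q0 _ _] _].
  by rewrite setU_eq0 (negPf q0).
have [W2 [W2S c2 d2]] : exists W : {set V}, [/\ W \subset W1, (#|W1| <= #|W| + #|B2|)%N &
    forall i, i \in B2 -> ~~ (i.1.1 :|: i.1.2 :|: i.2 \subset W)].
  apply: exists_hitting_deletion => q; rewrite inE => /andP [/and4P [/Gn0 q0 _ _ _] _].
  by rewrite !setU_eq0 (negPf q0).
have [W [WS c3 d3]] : exists W : {set V}, [/\ W \subset W2, (#|W2| <= #|W| + #|B3|)%N &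
    forall i, i \in B3 -> ~~ (i \subset W)].
  apply: exists_hitting_deletion => A; rewrite inE => /andP [/eqP Ar _].
  by rewrite -card_gt0 Ar; exact: leq_trans r3.
have WW1 : W \subset W1 by exact: subset_trans WS W2S.
have WSS : W \subset S by exact: subset_trans WW1 W1S.
have b40 : 0 <= b4 S.
  by apply: sumr_ge0 => g _; rewrite mulr_ge0 // exprn_ge0 // invr_ge0 ltW.
have tC0 : 0 < t / (4 * C) by rewrite divr_gt0 // mulr_gt0.
have cW : #|S|%:R - b1 S - b2 S - b3 S <= #|W|%:R :> R.
  rewrite /b1 /b2 /b3 !cardB -/B1 -/B2 -/B3.
  have : (#|S| <= #|W| + #|B3| + #|B2| + #|B1|)%N by clear -c1 c2 c3; lia.
  by rewrite -(ler_nat R) !natrD -!lerBlDr.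
have h0 : 0 <= t / (4 * C) * b4 S by rewrite mulr_ge0 // ltW.
exists W => F; split.
- apply: le_trans PS _; apply: le_trans cW.
  by rewrite /Phi lerBlDr lerDl.
- move=> e g; rewrite !inE => /andP [eG eW] /andP [gG gW]; apply/negP => bad.
  have := d1 (e, g); rewrite inE /P1 /= eG gG bad /= subUset.
  rewrite (subset_trans eW WSS) (subset_trans gW WSS) => /(_ isT).
  by rewrite subUset (subset_trans eW WW1) (subset_trans gW WW1).
- move=> g g1 g3; rewrite !inE => /andP [gG gW] /andP [g1G g1W] /andP [g3G g3W].
  apply/negP => bad; have := d2 (g, g1, g3).
  rewrite inE /P2 /= gG g1G g3G bad /= !subUset.
  rewrite (subset_trans gW WSS) (subset_trans g1W WSS) (subset_trans g3W WSS).
  move=> /(_ isT).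
  by rewrite (subset_trans gW WS) (subset_trans g1W WS) (subset_trans g3W WS).
- move=> A Ar; have [AW|AW] := boolP (A \subset W); last first.
    rewrite (_ : [set _ in F | _] = set0) ?cards0 //; apply/setP => e; rewrite !inE.
    apply: contraNF AW => /and3P [/andP [_ eW] Ae _]; exact: subset_trans Ae eW.
  have : A \notin B3 by apply: contraL AW => /d3.
  rewrite inE Ar eqxx (subset_trans AW WSS) /= -ltnNge => h.
  apply: leq_trans (ltnW h).
  apply: leq_trans (leq_imset_card (fun x => x |: A) _).
  apply: subset_leq_card; apply/subsetP => e.
  rewrite !inE => /and3P [/andP [eG eW] Ae /eqP ce].
  have : #|e :\: A| = 1%N by rewrite cardsD (setIidPr Ae) ce Ar subSnn.
  move=> /eqP /cards1P [x xE].
  have /setDP [xe xA] : x \in e :\: A by rewrite xE set11.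
  have eE : x |: A = e by rewrite -xE -{2}(setIidPr Ae) setUC setID.
  apply/imsetP; exists x => //.
  by rewrite !inE xA eE eG (subsetP WSS) // (subsetP eW).
- have b4F : \sum_(e in F) t^-1 ^+ #|e| <= b4 S.
    rewrite /b4 [leRHS](bigID (fun g : {set V} => g \subset W)) /= -[leLHS]addr0.
    apply: lerD; last first.
      by apply: sumr_ge0 => g _; rewrite mulr_ge0 // exprn_ge0 // invr_ge0 ltW.
    rewrite le_eqVlt; apply/orP; left; apply/eqP.
    apply: eq_big => [g|g]; rewrite inE // => /andP [_ gW].
    by rewrite (subset_trans gW WSS) mulr1.
  apply: le_trans b4F _.
  have : t / (4 * C) * b4 S <= #|W|%:R.
    apply: le_trans cW; rewrite -subr_ge0; apply: le_trans PS.
    by rewrite divr_ge0.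
  rewrite -ler_pdivlMl //; congr (_ <= _); field; rewrite !gt_eqF //.
Qed.

End Cleaning.

(** * Expected numbers of bad configurations *)

Lemma leq_bin_exp n k : ('C(n, k) <= n ^ k)%N.
Proof.
elim: k n => [|k IH] [|n]; rewrite ?bin0 // ?bin0n //.
have := mul_bin_diag n.+1 k; rewrite expnS => E.
apply: leq_trans (_ : k.+1 * 'C(n.+1, k.+1) <= _)%N; first by rewrite leq_pmull.
rewrite -E leq_mul2l /=; apply: leq_trans (IH n) _.
by case: k {IH E} => // k; rewrite leq_exp2r.
Qed.

Section FirstMoments.
Variables (R : realType) (V : finType) (G : {set {set V}}) (r : nat).
Variables (p K m : R).
Hypothesis p01 : 0 < p <= 1.
Hypothesis K1 : 1 <= K.
Hypothesis m0 : 0 < m.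
Hypothesis r3 : (3 <= r)%N.
Hypothesis Gsize : forall e, e \in G -> (r <= #|e| <= r.+1)%N.
Implicit Types (g J U : {set V}).

(** The expected number of members of G completed by the random set, given that
    it contains J. *)
Definition link_sum J : R := \sum_(g in G | J \subset g) p ^+ #|g :\: J|.

Hypothesis link_le : forall J, J != set0 -> link_sum J <= K.
Hypothesis link_small : forall J, (2 <= #|J| < r)%N -> link_sum J <= K / m.

Local Notation pn := (p * #|V|%:R).
Let p0 : 0 < p. Proof. by case/andP: p01. Qed.
Let pX i : 0 <= p ^+ i. Proof. by rewrite exprn_ge0 // ltW. Qed.
Let K0 : 0 <= K. Proof. exact: le_trans ler01 K1. Qed.
Let Km0 : 0 <= K / m. Proof. by rewrite divr_ge0 // ltW. Qed.

(** Classify the edges by their trace J on U; there are 2^|U| traces. *)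
Lemma sum_meet U (P : pred {set V}) (B : R) : 0 <= B ->
  (forall J, J \subset U -> P J -> link_sum J <= B) ->
  \sum_(g in G | P (g :&: U)) p ^+ #|g :\: U| <= 2 ^+ #|U| * B.
Proof.
move=> B0 H.
rewrite (partition_big (fun g => g :&: U) (fun J => (J \subset U) && P J)) /=;
  last by move=> g /andP [_ Pg]; rewrite subsetIr.
apply: le_trans (_ : \sum_(J : {set V} | (J \subset U) && P J) B <= _).
  apply: ler_sum => J /andP [JU PJ]; apply: le_trans (H J JU PJ).
  rewrite /link_sum [leRHS](bigID (fun g => P (g :&: U) && (g :&: U == J))) /=.
  rewrite -[leLHS]addr0; apply: lerD; last by apply: sumr_ge0.
  rewrite le_eqVlt; apply/orP; left; apply/eqP; apply: eq_big => g.
    case: (g \in G) => //=; case gJ: (g :&: U == J); rewrite ?andbF ?andbT //.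
    by rewrite -(eqP gJ) subsetIl.
  by move=> /andP [_ /eqP <-]; rewrite setDIr setDv set0U.
apply: le_trans (_ : \sum_(J in powerset U) B <= _); last first.
  by rewrite sumr_const card_powerset -[leLHS]mulr_natl natrX.
rewrite [leRHS](bigID P) /= -[leLHS]addr0; apply: lerD; last exact: sumr_ge0.
rewrite le_eqVlt; apply/orP; left; apply/eqP.
by apply: eq_bigl => J; rewrite powersetE.
Qed.

Lemma sum_edges_le : \sum_(g in G) p ^+ #|g| <= pn * K.
Proof.
apply: le_trans (_ : \sum_(v : V) p * link_sum [set v] <= _); last first.
  have -> : pn * K = \sum_(v : V) p * K by rewrite sumr_const -[RHS]mulr_natr mulrAC.
  apply: ler_sum => v _; rewrite ler_wpM2l ?(ltW p0) // link_le //.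
  by apply/set0Pn; exists v; rewrite set11.
rewrite /link_sum; under [leRHS]eq_bigr => v _ do rewrite mulr_sumr.
rewrite [leRHS](exchange_big_dep (fun g => g \in G)) /=; last by move=> ? ? _ /andP [].
apply: ler_sum => g gG.
have /card_gt0P [v vg] : (0 < #|g|)%N by have := Gsize gG; lia.
rewrite (bigD1 v) /=; last by rewrite gG sub1set.
rewrite -[leLHS]addr0; apply: lerD; last first.
  by apply: sumr_ge0 => u _; rewrite mulr_ge0 // ltW.
by rewrite -exprS (cardsD1 v g) vg.
Qed.

Let two_pow U (i : nat) : (#|U| <= i)%N -> 2 ^+ #|U| <= 2 ^+ i :> R.
Proof. by move=> h; rewrite ler_eXn2l // ltr1n. Qed.

(** Choose an edge, then one that meets it in a set of size between 2 and r - 1. *)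
Lemma sum_pairs_le :
  \sum_(q : {set V} * {set V} | [&& q.1 \in G, q.2 \in G & bad_pair r q.1 q.2])
    p ^+ #|q.1 :|: q.2| <= pn * K * (2 ^+ r.+1 * (K / m)).
Proof.
rewrite -(pair_big_dep (fun g => g \in G)
   (fun g g' => (g' \in G) && bad_pair r g g') (fun g g' => p ^+ #|g :|: g'|)) /=.
apply: le_trans (_ : \sum_(g in G) p ^+ #|g| * (2 ^+ r.+1 * (K / m)) <= _).
  apply: ler_sum => g gG.
  apply: le_trans (_ : p ^+ #|g| * (2 ^+ #|g| * (K / m)) <= _); last first.
    rewrite ler_wpM2l // ler_wpM2r // two_pow //.
    by have /andP [] := Gsize gG.
  apply: le_trans (_ : p ^+ #|g| * \sum_(g' in G | (2 <= #|g' :&: g| < r)%N)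
     p ^+ #|g' :\: g| <= _); last first.
    rewrite ler_wpM2l //.
    apply: (sum_meet (P := fun J => (2 <= #|J| < r)%N)) => // J _ hJ.
    exact: link_small.
  rewrite mulr_sumr.
  rewrite [leRHS](bigID (fun g' => bad_pair r g g')) /= -[leLHS]addr0.
  apply: lerD; last by apply: sumr_ge0 => g' _; rewrite mulr_ge0.
  rewrite le_eqVlt; apply/orP; left; apply/eqP; apply: eq_big => [g'|g' _].
    rewrite -andbA; congr (_ && _); rewrite /bad_pair setIC.
    by case: (_ < _ < _)%N; rewrite ?andbF ?andbT.
  by rewrite -exprD -(cardsID g (g :|: g')) setUK setDUl setDv set0U.
have c0 : 0 <= 2 ^+ r.+1 * (K / m) by rewrite mulr_ge0 // exprn_ge0.
by rewrite -mulr_suml (ler_wpM2r c0) // sum_edges_le.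
Qed.

(** Choose two edges that meet, then a third that has exactly two vertices in
    their union.  Pairs of vertices have a small link_sum, which gives the
    factor 1 / m. *)
Lemma sum_triples_le :
  \sum_(q : {set V} * {set V} * {set V} |
      [&& q.1.1 \in G, q.1.2 \in G, q.2 \in G & bad_triple q.1.1 q.1.2 q.2])
    p ^+ #|q.1.1 :|: q.1.2 :|: q.2| <=
  pn * K * (2 ^+ r.+1 * K) * (2 ^+ (r.+1 + r.+1) * (K / m)).
Proof.
set c1 := 2 ^+ r.+1 * K; set c2 := 2 ^+ (r.+1 + r.+1) * (K / m).
have c10 : 0 <= c1 by rewrite mulr_ge0 ?exprn_ge0.
have c20 : 0 <= c2 by rewrite mulr_ge0 ?exprn_ge0.
have -> : \sum_(q : {set V} * {set V} * {set V} |
      [&& q.1.1 \in G, q.1.2 \in G, q.2 \in G & bad_triple q.1.1 q.1.2 q.2])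
    p ^+ #|q.1.1 :|: q.1.2 :|: q.2| =
  \sum_(g1 in G) \sum_(g3 in G) \sum_(g in G | bad_triple g g1 g3)
     p ^+ #|g :|: g1 :|: g3|.
  rewrite pair_big /=.
  rewrite (pair_big_dep (fun q : {set V} * {set V} => (q.1 \in G) && (q.2 \in G))
    (fun q g => (g \in G) && bad_triple g q.1 q.2)
    (fun q g => p ^+ #|g :|: q.1 :|: q.2|)) /=.
  rewrite (reindex (fun q : {set V} * {set V} * {set V} => (q.2, q.1.1, q.1.2))) /=.
    apply: eq_bigl => -[[g1 g3] g] /=.
    by case: (g \in G); rewrite ?andbF // -!andbA.
  by exists (fun q => (q.1.2, q.2, q.1.1)) => -[[? ?] ?].
apply: le_trans (_ : \sum_(g1 in G) p ^+ #|g1| * (c1 * c2) <= _); last first.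
  by rewrite -mulr_suml -[leRHS]mulrA (ler_wpM2r (mulr_ge0 c10 c20)) // sum_edges_le.
apply: ler_sum => g1 g1G.
apply: le_trans (_ : \sum_(g3 in G | g3 :&: g1 != set0)
    p ^+ #|g1| * p ^+ #|g3 :\: g1| * c2 <= _); last first.
  rewrite -mulr_suml -mulr_sumr mulrA ler_wpM2r // ler_wpM2l //.
  apply: le_trans (sum_meet (P := fun J => J != set0) (B := K) _ _) _ => //.
    by move=> J _; exact: link_le.
  by rewrite ler_wpM2r // two_pow //; have /andP [] := Gsize g1G.
rewrite [leLHS](bigID (fun g3 => g3 :&: g1 != set0)) /=.
rewrite [X in _ + X]big1 ?addr0; last first.
  move=> g3 /andP [_ /negPn /eqP i0]; rewrite big1 // => g /andP [_].
  by rewrite /bad_triple [g1 :&: g3]setIC i0 eqxx !andbF.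
apply: ler_sum => g3 /andP [g3G _].
have c13 : (#|g1 :|: g3| <= r.+1 + r.+1)%N.
  apply: leq_trans (leq_card_setU _ _) _; apply: leq_add.
    by have /andP [] := Gsize g1G.
  by have /andP [] := Gsize g3G.
apply: le_trans (_ : p ^+ #|g1| * p ^+ #|g3 :\: g1| *
   \sum_(g in G | #|g :&: (g1 :|: g3)| == 2%N) p ^+ #|g :\: (g1 :|: g3)| <= _);
   last first.
  rewrite ler_wpM2l ?mulr_ge0 //.
  apply: le_trans (sum_meet (P := fun J => #|J| == 2%N) (B := K / m) _ _) _ => //.
    by move=> J _ /eqP J2; apply: link_small; rewrite J2.
  by rewrite ler_wpM2r // two_pow.
rewrite mulr_sumr.
rewrite [leRHS](bigID (fun g => bad_triple g g1 g3)) /= -[leLHS]addr0.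
apply: lerD; last by apply: sumr_ge0 => g _; rewrite !mulr_ge0.
rewrite le_eqVlt; apply/orP; left; apply/eqP; apply: eq_big => [g|g _].
  rewrite -andbA; congr (_ && _); case bt: (bad_triple _ _ _); rewrite ?andbF //.
  have /and4P [/eqP h1 /eqP h2 /eqP h3 _] := bt.
  by rewrite setIUr cardsU h1 h2 setIACA setIid setIA h3 cards0.

rewrite -!exprD; congr (_ ^+ _).
rewrite -setUA [g :|: _]setUC -(cardsID (g1 :|: g3) (g1 :|: g3 :|: g)) setUK.
rewrite setDUl setDv set0U; congr (_ + _)%N.
by rewrite -(cardsID g1 (g1 :|: g3)) setUK setDUl setDv set0U.
Qed.

(** Here (1 + p)^j is the mean of 2 to the number of sampled extensions when there
    are j of them, and (1 + p)^j <= exp (p j). *)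
Lemma sum_stars_le (t : R) (tau : nat) :
  (forall A : {set V}, #|A| = r -> p * #|extensions G A|%:R <= t) ->
  \sum_(A : {set V} | #|A| == r) p ^+ r * (1 + p) ^+ #|extensions G A| / 2 ^+ tau
    <= pn ^+ r * expR t / 2 ^+ tau.
Proof.
move=> H; rewrite -mulr_suml ler_wpM2r ?invr_ge0 ?exprn_ge0 //.
apply: le_trans (_ : \sum_(A : {set V} | #|A| == r) p ^+ r * expR t <= _).
  apply: ler_sum => A /eqP Ar; rewrite ler_wpM2l //.
  apply: le_trans (_ : expR p ^+ #|extensions G A| <= _).
    by rewrite lerXn2r ?nnegrE ?expR_ge0 ?addr_ge0 ?(ltW p0) // expR_ge1Dx.
  by rewrite -expRM_natl mulrC ler_expR H.
rewrite sumr_const -[leLHS]mulr_natl exprMn mulrA ler_wpM2r ?expR_ge0 //.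
rewrite mulrC ler_wpM2l // -natrX ler_nat.
by rewrite -[X in (X <= _)%N]cardsE card_draws leq_bin_exp.
Qed.

End FirstMoments.

(** * Contracting the sets of large degree *)

Section Reduction.
Variables (R : realType) (V : finType) (r : nat) (H : kgraph r.+1 V) (m : R).
Hypothesis r3 : (3 <= r)%N.
Hypothesis m0 : 0 < m.
Hypothesis V0 : (0 < #|V|)%N.
Implicit Types (A J S e g : {set V}).

Local Notation n := (#|V|%:R : R).
Hypothesis deg_codim2 : forall S, #|S| = r.-1 ->
  (deg H S)%:R <= n ^+ 2 / m ^+ r.

Let n0 : 0 < n. Proof. by rewrite ltr0n. Qed.

(** An r-set of degree n / m has about t extensions in the sample.  A heavier set
    is worth treating as an edge of its own, and there are few such sets. *)
Definition heavy : {set {set V}} :=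
  [set A : {set V} | (#|A| == r) && (n / m <= (deg H A)%:R)].

Definition contraction : {set {set V}} :=
  heavy :|: [set e in edges H | [forall A in heavy, ~~ (A \subset e)]].

(** An edge containing J contains some x outside J. *)
Lemma deg_setU1_le J : (#|J| <= r)%N ->
  (deg H J <= \sum_(x | x \notin J) deg H (x |: J))%N.
Proof.
move=> Jr.
apply: leq_trans (_ : #|\bigcup_(x | x \notin J)
    [set e in edges H | x |: J \subset e]| <= _)%N.
  apply: subset_leq_card; apply/subsetP => e; rewrite inE => /andP [eH Je].
  have : ~~ (e \subset J).
    by apply/negP => /subset_leq_card; rewrite (edges_card eH) ltnNge Jr.
  case/subsetPn => x xe xJ; apply/bigcupP; exists x => //.
  by rewrite inE eH subUset sub1set xe.
apply: (big_ind2 (fun (A : {set {set V}}) k => #|A| <= k)%N) => //.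
  by rewrite cards0.
move=> A1 n1 A2 n2 h1 h2; apply: leq_trans (leq_card_setU _ _) _.
exact: leq_add.
Qed.

Lemma deg_le i J : (#|J| + i.+1)%N = r -> (deg H J)%:R <= n ^+ i.+2 / m ^+ r.
Proof.
elim: i J => [|i IH] J Ji; first by apply: deg_codim2; rewrite -Ji addn1.
have Jr : (#|J| <= r)%N by rewrite -Ji leq_addr.
apply: le_trans (_ : (\sum_(x | x \notin J) deg H (x |: J))%:R <= _).
  by rewrite ler_nat deg_setU1_le.
rewrite natr_sum; apply: le_trans (_ : \sum_(x : V) n ^+ i.+2 / m ^+ r <= _).
  rewrite [leRHS](bigID (fun x => x \notin J)) /= -[leLHS]addr0.
  apply: lerD; last first.
    by apply: sumr_ge0 => x _; rewrite divr_ge0 ?exprn_ge0 // ltW.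
  apply: ler_sum => x xJ; apply: IH.
  by rewrite cardsU1 xJ -Ji add1n addSnnS.
by rewrite sumr_const -[leLHS]mulr_natl mulrA -exprS.
Qed.

Lemma sum_deg_le J :
  (\sum_(A : {set V} | (#|A| == r) && (J \subset A)) deg H A <=
   r.+1 * deg H J)%N.
Proof.
rewrite /deg; under eq_bigr => A _ do rewrite -sum1_card.
rewrite (exchange_big_dep (fun e => (e \in edges H) && (J \subset e))) /=.
  rewrite mulnC -[X in (_ <= X * _)%N]sum1_card big_distrl /=.
  rewrite [X in (_ <= X)%N](eq_bigl (fun e => (e \in edges H) && (J \subset e)));
    last by move=> e; rewrite inE.
  apply: leq_sum => e /andP [eH _]; rewrite mul1n sum1_card.
  have rE : #|[set A : {set V} | A \subset e & #|A| == r]| = r.+1.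
    by rewrite cards_draws (edges_card eH) binSn.
  rewrite -[X in (_ <= X)%N]rE.
  apply: subset_leq_card; apply/subsetP => A.
  rewrite inE [A \in _]inE /= => /andP [/andP [Ar _]].
  by rewrite inE => /andP [_ ->].
move=> A e /andP [_ JA]; rewrite !inE => /andP [-> Ae].
exact: subset_trans JA Ae.
Qed.

(** Double counting of the pairs (A, e) with J in A and A in e: an edge has only
    r + 1 subsets of size r, and a heavy set has degree at least n / m. *)
Lemma heavy_le i J : (#|J| + i.+1)%N = r ->
  #|[set A in heavy | J \subset A]|%:R <= r.+1%:R * (n ^+ i.+1 / m ^+ r.-1).
Proof.
move=> Ji.
have D0 : 0 < n / m by rewrite divr_gt0.
have h1 : #|[set A in heavy | J \subset A]|%:R * (n / m) <= r.+1%:R * (deg H J)%:R.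
  rewrite -natrM; apply: le_trans (_ : (\sum_(A : {set V} |
      (#|A| == r) && (J \subset A)) deg H A)%:R <= _); last first.
    by rewrite ler_nat sum_deg_le.
  rewrite mulr_natl -sumr_const natr_sum.
  rewrite [leRHS](bigID (fun A => A \in [set A in heavy | J \subset A])) /=.
  rewrite -[leLHS]addr0; apply: lerD; last exact: sumr_ge0.
  rewrite [leRHS](eq_bigl (fun A => A \in [set A in heavy | J \subset A])).
    by apply: ler_sum => A; rewrite !inE => /andP [/andP [_]].
  move=> A; rewrite !inE; case: (_ == r) => //=.
  by case: (J \subset A); rewrite ?andbF.
have h2 := deg_le Ji.
rewrite -(ler_pM2r D0); apply: le_trans h1 _.
apply: le_trans (_ : r.+1%:R * (n ^+ i.+2 / m ^+ r) <= _).
  by rewrite ler_wpM2l.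
rewrite le_eqVlt; apply/orP; left; apply/eqP.
have -> : m ^+ r = m ^+ r.-1 * m by rewrite -exprSr prednK // (leq_trans _ r3).
rewrite [n ^+ i.+2]exprSr; field.
have mn : m != 0 by rewrite gt_eqF.
by rewrite ?expf_neq0 ?mn.
Qed.

Lemma contraction_size g : g \in contraction -> (r <= #|g| <= r.+1)%N.
Proof.
rewrite !inE => /orP [/andP [/eqP -> _]|/andP [/edges_card -> _]].
  by rewrite leqnn leqnSn.
by rewrite leqnn leqnSn.
Qed.

Lemma contraction_edge g : g \in contraction -> (r < #|g|)%N ->
  g \in edges H /\ forall A, A \in heavy -> ~~ (A \subset g).
Proof.
rewrite inE => /orP [|].
  by rewrite inE => /andP [/eqP -> _]; rewrite ltnn.
by rewrite inE => /andP [gH /forall_inP h].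
Qed.

Lemma contraction_heavy g : g \in contraction -> (#|g| <= r)%N -> g \in heavy.
Proof.
rewrite inE => /orP [//|]; rewrite inE => /andP [gH _].
by rewrite (edges_card gH) ltnn.
Qed.

Lemma contraction_anti e g : e \in contraction -> g \in contraction -> e \subset g -> e = g.
Proof.
move=> eG gG eg; apply/eqP; rewrite eqEcard eg /=.
have /andP [_ g1] := contraction_size gG; have /andP [e1 _] := contraction_size eG.
have [//|lt] := leqP #|g| #|e|.
have er : (#|e| <= r)%N by rewrite -ltnS; exact: leq_trans lt g1.
have [_ h] := contraction_edge gG (leq_ltn_trans e1 lt).
by have := h _ (contraction_heavy eG er); rewrite eg.
Qed.

Lemma contraction_indep (I : {set V}) : (forall g, g \in contraction -> ~~ (g \subset I)) ->
  independent H I.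
Proof.
move=> h; apply/forall_inP => e eH.
have [/forall_inP e1|] := boolP [forall A in heavy, ~~ (A \subset e)].
  by apply: h; rewrite !inE eH; apply/orP; right; apply/forall_inP.
rewrite negb_forall => /existsP [A]; rewrite negb_imply negbK => /andP [Ah Ae].
have := h A; rewrite inE Ah => /(_ isT); apply: contra => eI.
exact: subset_trans Ae eI.
Qed.

Section Density.
Variable s : R.
Hypothesis s1 : 1 <= s.
Let q : R := m * s / n.
Let s0 : 0 < s. Proof. exact: lt_le_trans ltr01 s1. Qed.
Let q0 : 0 < q. Proof. by rewrite divr_gt0 // mulr_gt0. Qed.

(** For |J| = j and edges of size s the degree bound n^(s-j) / m^(s-1), times
    (m z / n)^(s-j) for a density m z / n, is z^(s-j) m^(1-j). *)
Lemma contraction_link_le J : (#|J| < r)%N ->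
  link_sum contraction q J <= r.+2%:R * s ^+ r.+1 * m / m ^+ #|J|.
Proof.
move=> Jr; pose i := (r - #|J|.+1)%N.
have Ji : (#|J| + i.+1)%N = r by rewrite addnS -addSn /i subnKC.
have qX k : 0 <= q ^+ k by rewrite exprn_ge0 // ltW.
have split_le : link_sum contraction q J <=
    (deg H J)%:R * q ^+ i.+2 + #|[set A in heavy | J \subset A]|%:R * q ^+ i.+1.
  rewrite /link_sum (bigID (fun g => (r < #|g|)%N)) /=; apply: lerD.
    apply: le_trans (_ : \sum_(e in [set e in edges H | J \subset e]) q ^+ i.+2 <= _).
      rewrite [leRHS](bigID (fun e => e \in contraction)) /= -[leLHS]addr0.
      apply: lerD; last exact: sumr_ge0.
      rewrite le_eqVlt; apply/orP; left; apply/eqP; apply: eq_big => [g|g].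
        rewrite [X in _ = X && _]inE.
        case gG: (g \in contraction); rewrite ?andbF //=.
        case Jg: (J \subset g); rewrite ?andbF //= !andbT.
        apply/idP/idP => [lt|gH]; first by have [] := contraction_edge gG lt.
        by rewrite (edges_card gH).
      move=> /andP [/andP [gG Jg] lt]; have [gH _] := contraction_edge gG lt.
      congr (_ ^+ _); rewrite cardsD (setIidPr Jg) (edges_card gH) -Ji.
      by rewrite -addnS addKn.
    by rewrite sumr_const -[leLHS]mulr_natl.
  rewrite mulr_natl -sumr_const le_eqVlt; apply/orP; left; apply/eqP.
  apply: eq_big => [g|g].
    rewrite -leqNgt [RHS]inE.
    case gG: (g \in contraction) => /=; last first.
      by case gh: (g \in heavy) => //; rewrite inE gh in gG.
    rewrite andbC; congr (_ && _); apply/idP/idP; first exact: contraction_heavy.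
    by rewrite inE => /andP [/eqP ->].
  move=> /andP [/andP [gG Jg]]; rewrite -leqNgt => le.
  have := contraction_heavy gG le; rewrite inE => /andP [/eqP gr _].
  by congr (_ ^+ _); rewrite cardsD (setIidPr Jg) gr -Ji addKn.
apply: le_trans split_le _.
have d1 := deg_le Ji; have d2 := heavy_le Ji.
have Er : r.-1 = (#|J| + i)%N by rewrite -Ji addnS.
have mX k : m ^+ k != 0 by rewrite expf_neq0 // gt_eqF.
have nX k : n ^+ k != 0 by rewrite expf_neq0 // gt_eqF.
have e1 : (deg H J)%:R * q ^+ i.+2 <= s ^+ i.+2 * m / m ^+ #|J|.
  apply: le_trans (_ : n ^+ i.+2 / m ^+ r * q ^+ i.+2 <= _).
    by rewrite ler_wpM2r.
  rewrite le_eqVlt; apply/orP; left; apply/eqP.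
  rewrite -{1}Ji exprD [m ^+ i.+1]exprS /q expr_div_n exprMn [m ^+ i.+2]exprS.
  by rewrite [m ^+ i.+1]exprS; field; rewrite !mX !nX gt_eqF.
have e2 : #|[set A in heavy | J \subset A]|%:R * q ^+ i.+1 <=
    r.+1%:R * (s ^+ i.+1 * m / m ^+ #|J|).
  apply: le_trans (_ : r.+1%:R * (n ^+ i.+1 / m ^+ r.-1) * q ^+ i.+1 <= _).
    by rewrite ler_wpM2r.
  rewrite le_eqVlt; apply/orP; left; apply/eqP.
  rewrite Er exprD /q expr_div_n exprMn [m ^+ i.+1]exprS.
  by field; rewrite !mX !nX.
have sX k : (k <= r.+1)%N -> s ^+ k <= s ^+ r.+1 by move=> kr; rewrite ler_weXn2l.
have c0 : 0 <= m / m ^+ #|J| by rewrite divr_ge0 ?exprn_ge0 // ltW.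
apply: le_trans (lerD e1 e2) _.
apply: le_trans (_ : s ^+ r.+1 * (m / m ^+ #|J|) +
   r.+1%:R * (s ^+ r.+1 * (m / m ^+ #|J|)) <= _).
  rewrite -!(mulrA _ m); apply: lerD; last rewrite ler_wpM2l //.
    by rewrite ler_wpM2r // sX // -Ji -addnS leq_addl.
  by rewrite ler_wpM2r // sX // -Ji (leq_trans (leq_addl _ _) (leqnSn _)).
rewrite -[X in X + _]mul1r -mulrDl addrC natr1.
by rewrite !mulrA.
Qed.

(** An r-set that is not heavy has degree at most n / m; every other set of size at
    least r is contained in no member but possibly itself. *)
Lemma contraction_link_top J : (r <= #|J|)%N -> link_sum contraction q J <= s.
Proof.
move=> rJ; rewrite /link_sum.
have [JG|JG] := boolP (J \in contraction).
  rewrite (big_pred1 J) ?setDv ?cards0 // => g.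
  apply/andP/eqP => [[gG Jg]|->]; last by rewrite JG.
  by rewrite (contraction_anti JG gG Jg).
have ed g : g \in contraction -> J \subset g ->
    [/\ g \in edges H, #|J| = r & #|g :\: J| = 1%N].
  move=> gG Jg; have /andP [_ gr] := contraction_size gG.
  have lt : (#|J| < #|g|)%N.
    apply: proper_card; rewrite properE Jg /=; apply: contra JG => gJ.
    by rewrite (_ : J = g) //; apply/eqP; rewrite eqEsubset Jg.
  have Jr : #|J| = r by apply/eqP; rewrite eqn_leq rJ andbT -ltnS (leq_trans lt).
  rewrite Jr in lt; have [gH _] := contraction_edge gG lt.
  by rewrite cardsD (setIidPr Jg) Jr (edges_card gH) subSnn.
have [g0 /andP [g0G Jg0]|none] := pickP [pred g in contraction | J \subset g]; last first.
  by rewrite big_pred0 ?(ltW s0).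
have [_ Jr _] := ed _ g0G Jg0.
have light : (deg H J)%:R <= n / m.
  have := JG; rewrite !inE Jr eqxx /= negb_or -ltNge => /andP [/ltW //].
apply: le_trans (_ : \sum_(e in [set e in edges H | J \subset e]) q <= _).
  rewrite [leRHS](bigID (fun e => e \in contraction)) /= -[leLHS]addr0.
  apply: lerD; last by apply: sumr_ge0 => e _; exact: ltW.
  rewrite le_eqVlt; apply/orP; left; apply/eqP; apply: eq_big => [g|g].
    rewrite [X in _ = X && _]inE.
    case gG: (g \in contraction); rewrite ?andbF //=.
    case Jg: (J \subset g); rewrite ?andbF //= !andbT.
    by have [-> _ _] := ed _ gG Jg.
  by move=> /andP [gG Jg]; have [_ _ ->] := ed _ gG Jg.
rewrite sumr_const -[leLHS]mulr_natl.
apply: le_trans (_ : n / m * q <= _); first by rewrite ler_wpM2r ?(ltW q0).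
rewrite le_eqVlt; apply/orP; left; apply/eqP; rewrite /q; field.
by rewrite !gt_eqF.
Qed.

Lemma contraction_ext_le A : #|A| = r -> q * #|extensions contraction A|%:R <= s.
Proof.
move=> Ar; have [Ah|Ah] := boolP (A \in heavy).
  rewrite (_ : extensions contraction A = set0) ?cards0 ?mulr0 ?(ltW s0) //.
  apply/setP => x; rewrite [in RHS]inE inE; apply/negP => /andP [xA xG].
  have AG : A \in contraction by rewrite inE Ah.
  have /setP /(_ x) := contraction_anti AG xG (subsetUr _ _).
  by rewrite (negPf xA) setU11.
have light : (deg H A)%:R <= n / m.
  by have := Ah; rewrite inE Ar eqxx /= -ltNge => /ltW.
apply: le_trans (_ : q * (n / m) <= _); last first.
  rewrite le_eqVlt; apply/orP; left; apply/eqP; rewrite /q; field.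
  by rewrite !gt_eqF.
rewrite ler_wpM2l ?(ltW q0) //; apply: le_trans light; rewrite ler_nat.
rewrite -(card_in_imset (f := fun x => x |: A)).
  apply: subset_leq_card; apply/subsetP => e /imsetP [x].
  rewrite inE => /andP [xA xG] ->; rewrite inE subsetUr andbT.
  by have [] := contraction_edge xG _; rewrite // cardsU1 xA Ar.
move=> x y; rewrite !inE => /andP [xA _] /andP [yA _] /setP /(_ x).
by rewrite !inE eqxx (negPf xA) !orbF => /esym /eqP.
Qed.

End Density.

Lemma contraction_sum_le :
  \sum_(g in contraction) (m / n) ^+ #|g| <= r.+2%:R * m.
Proof.
have := @contraction_link_le 1 (lexx _) set0.
rewrite cards0 (leq_trans _ r3) // => /(_ isT).
rewrite expr0 divr1 expr1n !mulr1; apply: le_trans.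
rewrite le_eqVlt; apply/orP; left; apply/eqP; apply: eq_big => [g|g _].
  by rewrite sub0set andbT.
by rewrite setD0 .
Qed.

End Reduction.

(** * Clean hypergraphs *)

Section CleanFamily.
Variables (R : realType) (V : finType) (F : {set {set V}}) (W : {set V}).
Variables (r tau : nat) (L u alpha : R).
Let t : R := expR L.
Let k := r.+1.
Hypothesis r3 : (3 <= r)%N.
Hypothesis Fsize : forall e, e \in F -> (r <= #|e| <= r.+1)%N.
Hypothesis Fanti : forall e g, e \in F -> g \in F -> e \subset g -> e = g.
Hypothesis FW : forall e, e \in F -> e \subset W.
Hypothesis no_bad_pair : forall e g, e \in F -> g \in F -> ~~ bad_pair r e g.
Hypothesis no_bad_triple : forall g g1 g3, g \in F -> g1 \in F -> g3 \in F ->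
  ~~ bad_triple g g1 g3.
Hypothesis small_stars : forall A : {set V}, #|A| = r ->
  (#|[set e in F | (A \subset e) && (#|e| == r.+1)]| <= tau)%N.
Hypothesis tau0 : (0 < tau)%N.
Hypothesis tau_le : tau%:R <= 5 * t.
Hypothesis W0 : (0 < #|W|)%N.
Hypothesis few_edges_inside : \sum_(e in F) t^-1 ^+ #|e| <= 4 * r.+2%:R * #|W|%:R / t.
Hypothesis alphaP : forall I : {set V}, I \subset W ->
  (forall e, e \in F -> ~~ (e \subset I)) -> #|I|%:R <= alpha.
Hypothesis L256 : 256 <= L.
Hypothesis t_large : (512 * k%:R) ^+ 2 * r.+2%:R <= t.
Hypothesis uL : u ^+ r = L.
Hypothesis u1 : 1 <= u.

Local Notation N := (#|W|%:R : R).
Let a : R := expR (L / 8).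

Lemma expR_eighth_ge : 2 * L <= a.
Proof.
have hL := L256.
have h0 : 0 <= L / 8 by lra.
have h := expR_ge1Dxn 1 h0; rewrite -/a in h.
apply: le_trans h.
rewrite (_ : (1.+1)`!%:R = 2 :> R) //.
by nra.
Qed.

Lemma expR_eighth_pow : t = a ^+ 8.
Proof. by rewrite /a -expRM_natl /t; congr expR; field. Qed.

(** With a = exp (L / 8), so that t = a^8, the parameters are lam = a^(-6),
    theta = eta u / a^8 and M = 8 L.  If alpha were smaller than claimed, the
    exponent in independent_set_bound would be at least - L / 8, hence
    alpha >= a^(-7) N / 2, while theta <= a^(-7) / 4 since u <= L <= a / 2. *)
Lemma clean_family_alpha_ge :
  (1024 * k%:R)^-1 * (512 * k%:R * r.+2%:R)^-1 * u / t * N <= alpha.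
Proof.
set eta := (512 * k%:R * r.+2%:R)^-1.
have etaE : eta = (512 * k%:R * r.+2%:R)^-1 by [].
clearbody eta.
have ag := expR_eighth_ge; have hL := L256; have hu := u1.
have a1 : 1 <= a by lra.
have a0 : 0 < a by lra.
have k4 : 4 <= k%:R :> R by rewrite ler_nat.
have k0 : 0 < k%:R :> R by lra.
have r2 : 5 <= r.+2%:R :> R by rewrite ler_nat.
have r20 : 0 < r.+2%:R :> R by lra.
have r2' : 0 < 2 + r%:R :> R by rewrite -natrD ltr0n.
have eta0 : 0 < eta by rewrite etaE invr_gt0 !mulr_gt0.
have eta1 : eta <= 2^-1.
  rewrite etaE lef_pV2 ?posrE ?mulr_gt0 //.
  apply: le_trans (_ : 512 * 4 * 5 <= _); first by lra.
  by nra.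
have u0 : 0 < u by lra.
have uleL : u <= L by rewrite -uL ler_eXnr // (leq_trans _ r3).
have ua : u <= a / 2 by lra.
have N0 : 0 < N by rewrite ltr0n.
have aX i : 0 < a ^+ i by rewrite exprn_gt0.
have aXn0 i : a ^+ i != 0 by rewrite gt_eqF.
pose theta := eta * u / t.
pose lam : R := (a ^+ 6)^-1.
have lamE : lam = expR (- (3 / 4 * L)).
  by rewrite /lam /a -expRM_natl -expRN; congr expR; field.
have t8 := expR_eighth_pow.
have t0 : 0 < t by rewrite t8.
have theta0 : 0 < theta by rewrite divr_gt0 // mulr_gt0.
have theta_a7 : theta <= eta * (a ^+ 7)^-1 / 2.
  have -> : theta = eta * (a ^+ 7)^-1 * (u / a).
    by rewrite /theta t8; field; rewrite gt_eqF.
  have c0 : 0 <= eta * (a ^+ 7)^-1 by rewrite mulr_ge0 ?invr_ge0 ?(ltW eta0) ?(ltW (aX 7)).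
  by rewrite (ler_wpM2l c0) // ler_pdivrMr //; lra.
have a76 : (a ^+ 7)^-1 <= lam.
  by rewrite /lam lef_pV2 ?posrE // ler_weXn2l.
have theta_lam : theta <= lam.
  apply: le_trans theta_a7 _; apply: le_trans a76.
  have p0 : 0 <= (a ^+ 7)^-1 by rewrite invr_ge0 ltW.
  by rewrite -mulrA mulrCA ler_piMr //; lra.
have lam0 : 0 < lam by rewrite invr_gt0.
have lam_half : lam <= 2^-1.
  rewrite /lam lef_pV2 ?posrE //; apply: le_trans (_ : a ^+ 1 <= _); first by rewrite expr1; lra.
  by rewrite ler_weXn2l.
have a4 : 512 * k%:R <= a ^+ 4.
  have h1 : (512 * k%:R : R) \in Num.nneg by rewrite nnegrE; lra.
  have h2 : a ^+ 4 \in Num.nneg by rewrite nnegrE ltW.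
  rewrite -(ler_sqr h1 h2) -exprM -t8.
  by apply: le_trans t_large; rewrite ler_peMr ?sqr_ge0 //; lra.
have m_small : (k * tau)%:R * (theta + lam) ^+ 2 <= 2^-1.
  rewrite natrM.
  apply: le_trans (_ : k%:R * (5 * t) * (4 * lam ^+ 2) <= _).
    have A1 : k%:R * tau%:R <= k%:R * (5 * t) by rewrite ler_pM2l.
    have A2 : (theta + lam) ^+ 2 <= 4 * lam ^+ 2.
      have -> : 4 * lam ^+ 2 = (lam + lam) ^+ 2 by ring.
      by rewrite lerXn2r ?nnegrE ?addr_ge0 ?(ltW lam0) ?(ltW theta0) // lerD2r.
    by apply: ler_pM A1 A2; rewrite ?sqr_ge0 // mulr_ge0.
  have -> : k%:R * (5 * t) * (4 * lam ^+ 2) = 20 * k%:R / a ^+ 4.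
    by rewrite t8 /lam; field; rewrite gt_eqF.
  rewrite ler_pdivrMr //; lra.
pose kappa := 4 * r.+2%:R * (eta * L).
have sumF : \sum_(e in F) theta ^+ #|e| <= theta * (kappa * N).
  apply: le_trans (_ : \sum_(e in F) eta * u * (eta * L) * t^-1 ^+ #|e| <= _).
    apply: ler_sum => e eF; rewrite /theta expr_div_n -exprVn.
    rewrite ler_wpM2r ?exprn_ge0 ?invr_ge0 ?(ltW t0) //.
    have /andP [e1 e2] := Fsize eF.
    have e0 : (0 < #|e|)%N by apply: leq_trans e1; exact: leq_trans r3.
    rewrite -(prednK e0) exprS ler_wpM2l ?mulr_ge0 ?(ltW eta0) ?(ltW u0) //.
    rewrite exprMn; apply: ler_pM; rewrite ?exprn_ge0 ?(ltW eta0) ?(ltW u0) //.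
      rewrite -[leRHS]expr1 ler_wiXn2l ?(ltW eta0) //; first by lra.
      by rewrite -ltnS prednK // (leq_trans _ e1) // (leq_trans _ r3).
    by rewrite -uL ler_weXn2l // -ltnS prednK.
  rewrite -mulr_sumr.
  apply: le_trans (_ : eta * u * (eta * L) * (4 * r.+2%:R * N / t) <= _).
    have L0 : 0 <= L by lra.
    by rewrite ler_wpM2l // !mulr_ge0 ?(ltW eta0) ?(ltW u0).
  rewrite le_eqVlt; apply/orP; left; apply/eqP; rewrite /theta /kappa; field.
  by rewrite gt_eqF.
have M0 : 0 <= 8 * L by lra.
have Fcard e : e \in F -> (3 <= #|e| <= k)%N.
  by move=> /Fsize /andP [h1 ->]; rewrite (leq_trans r3 h1).
have colP v e x y : v \in W -> e \in F -> x \in e :&: link F v ->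
    y \in e :&: link F v -> cluster F v x = cluster F v y.
  by move=> _; exact: cluster_edge r3 Fsize Fanti no_bad_pair no_bad_triple _ _ _ _.
have blockP v c : v \in W ->
    (#|[set e in F | (v \in e) && (e :&: block F v (cluster F v) c != set0)]|
      <= k * tau)%N.
  by move=> _; exact: cluster_block r3 Fsize Fanti no_bad_pair tau0 small_stars v c.
have th01 : 0 < theta <= 2^-1 by rewrite theta0 (le_trans theta_lam).
have lam01 : 0 < lam <= 2^-1 by rewrite lam0.
have key := independent_set_bound th01 lam01 FW Fcard colP blockP m_small M0 W0
  alphaP sumF.
rewrite leNgt; apply/negP => small.
(* Each of the three terms of the exponent is at most L / 128. *)
have E1 : k%:R / theta * (8 * L * (alpha / N)) <= L / 128.
  have -> : L / 128 = k%:R / theta * (8 * L * ((1024 * k%:R)^-1 * theta)).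
    by field; rewrite !gt_eqF.
  have kt0 : 0 < k%:R / theta by rewrite divr_gt0.
  have L80 : 0 < 8 * L by lra.
  rewrite (ler_pM2l kt0) (ler_pM2l L80) ler_pdivrMr // mulrA.
  by move: (ltW small); rewrite /theta !mulrA.
have E2 : k%:R / theta * (4 * lam * expR (- (8 * L / 4))) <= L / 128.
  have -> : expR (- (8 * L / 4)) = (a ^+ 16)^-1.
    by rewrite /a -expRM_natl -expRN; congr expR; field.
  have -> : k%:R / theta * (4 * lam * (a ^+ 16)^-1) =
     2048 * k%:R ^+ 2 * r.+2%:R / (u * a ^+ 14).
    by rewrite /theta /lam t8 etaE; field; rewrite !gt_eqF.
  rewrite ler_pdivrMr ?mulr_gt0 //.
  apply: le_trans (_ : 1 * (1 * a ^+ 8) <= _).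
    rewrite !mul1r -t8; apply: le_trans t_large.
    by rewrite exprMn (ler_pM2r r20) ler_pM2r ?exprn_gt0 //; lra.
  apply: ler_pM; rewrite ?mul1r ?(ltW (aX 8)) //; first by lra.
  rewrite -[leLHS]mul1r; apply: ler_pM; rewrite ?(ltW (aX 8)) //.
  by rewrite ler_weXn2l.
have E3 : k%:R * kappa = L / 128.
  by rewrite /kappa etaE; field; rewrite !gt_eqF.
have E4 : a^-1 <= expR (- (4 * (k%:R / theta *
   (8 * L * (alpha / N) + 4 * lam * expR (- (8 * L / 4))) + k%:R * kappa))).
  rewrite /a -expRN ler_expR lerN2 E3 mulrDr; lra.
have E5 : lam / 2 * N * a^-1 <= alpha.
  apply: le_trans key; rewrite ler_wpM2l // mulr_ge0 ?(ltW N0) //.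
  by rewrite divr_ge0 // ltW.
have : alpha < alpha; last by rewrite ltxx.
apply: lt_le_trans small _; apply: le_trans E5.
have -> : lam / 2 * N * a^-1 = (a ^+ 7)^-1 / 2 * N.
  by rewrite /lam; field; rewrite gt_eqF.
rewrite ler_wpM2r ?(ltW N0) //.
have -> : (1024 * k%:R)^-1 * eta * u / t = (1024 * k%:R)^-1 * theta.
  by rewrite /theta !mulrA.
apply: le_trans (_ : 1 * theta <= _).
  rewrite ler_wpM2r ?(ltW theta0) // invf_le1 ?mulr_gt0 //; lra.
rewrite mul1r; apply: le_trans theta_a7 _.
have h2 : 0 < 2^-1 :> R by rewrite invr_gt0.
rewrite (ler_pM2r h2) ler_piMl //; first by rewrite invr_ge0 (ltW (aX 7)).
by lra.
Qed.

End CleanFamily.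

(** * Large scale: combining the steps *)

Lemma expR_half_le2 (R : realType) : expR (2^-1) <= 2 :> R.
Proof.
have h : 1 + - 2^-1 <= expR (- 2^-1) :> R by exact: expR_ge1Dx.
have e0 := expR_gt0 (2^-1 : R).
rewrite expRN in h.
have h2 : 2^-1 <= (expR 2^-1)^-1 :> R by apply: le_trans h; lra.
by rewrite lef_pV2 ?posrE in h2.
Qed.

Lemma expR_le_exp2 (R : realType) (x : R) (tau : nat) :
  2 * x <= tau%:R -> expR x <= 2 ^+ tau.
Proof.
move=> h; apply: le_trans (_ : expR (tau%:R * 2^-1) <= _).
  by rewrite ler_expR; lra.
by rewrite expRM_natl lerXn2r ?nnegrE ?expR_ge0 // expR_half_le2.
Qed.

Lemma exprn_le_fact_expR (R : realType) (x : R) (i : nat) :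
  0 <= x -> x ^+ i.+1 <= (i.+1)`!%:R * expR x.
Proof.
move=> x0; have h := expR_ge1Dxn i x0.
rewrite mulrC -ler_pdivrMr ?ltr0n ?fact_gt0 //.
by apply: le_trans h; rewrite lerDr.
Qed.

Lemma exists_nat_4_5 (R : realType) (t : R) : 1 <= t ->
  exists tau : nat, 4 * t <= tau%:R <= 5 * t.
Proof.
move=> t1; exists (Num.trunc (4 * t)).+1.
have h0 : 0 <= 4 * t by lra.
have /andP [h1 h2] := truncn_itv h0.
by rewrite ltW //= -natr1; lra.
Qed.

Section LargeScale.
Variables (R : realType) (V : finType) (r : nat) (H : kgraph r.+1 V) (L u : R).
Let t : R := expR L.
Let k := r.+1.
Let m : R := t ^+ (4 * k).
Local Notation n := (#|V|%:R : R).
Hypothesis r3 : (3 <= r)%N.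
Hypothesis V0 : (0 < #|V|)%N.
Hypothesis deg_codim2 : forall S : {set V}, #|S| = r.-1 ->
  (deg H S)%:R <= n ^+ 2 / m ^+ r.
Hypothesis mt_le : m * t <= n.
Hypothesis L256 : 256 <= L.
Hypothesis t_large1 : 16 * (((4 * k).+1 * r.-1).+1)`!%:R <= t.
Hypothesis t_large2 : 16 * 2 ^+ (3 * k) * r.+2%:R ^+ 3 <= t.
Hypothesis t_large3 : (512 * k%:R) ^+ 2 * r.+2%:R <= t.
Hypothesis uL : u ^+ r = L.
Hypothesis u1 : 1 <= u.

(** The sample has m t / 2 vertices or more, and a clean hypergraph on it has an
    independent set of density of order u / t. *)
Lemma large_scale_alpha_ge :
  (1024 * k%:R)^-1 * (512 * k%:R * r.+2%:R)^-1 / 2 * u * m <= (alpha H)%:R.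
Proof.
have hL := L256.
have t1 : 1 <= t.
  by apply: le_trans (expR_ge1Dx _); rewrite lerDl; lra.
have t0 : 0 < t by exact: lt_le_trans ltr01 t1.
have tX i : 1 <= t ^+ i by rewrite exprn_ege1.
have m1 : 1 <= m by exact: tX.
have m0 : 0 < m by exact: lt_le_trans ltr01 m1.
have n0 : 0 < n by rewrite ltr0n.
(* The sample has mean size m t. *)
pose p := m * t / n.
have p01 : 0 < p <= 1.
  by rewrite divr_gt0 ?mulr_gt0 //= ler_pdivrMr // mul1r.
have pnE : p * n = m * t by rewrite /p divfK // gt_eqF.
have [tau /andP [tau4 tau5]] := exists_nat_4_5 t1.
pose G := contraction H m.
pose K : R := r.+2%:R * t ^+ r.+1.
have r2 : 1 <= r.+2%:R :> R by rewrite ler1n.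
have K1 : 1 <= K by rewrite -[1]mulr1 ler_pM.
have K0 : 0 < K by exact: lt_le_trans ltr01 K1.
have Gsize e : e \in G -> (r <= #|e| <= r.+1)%N by exact: contraction_size.
have link_le (J : {set V}) : J != set0 -> link_sum G p J <= K.
  rewrite -card_gt0 => J0; have [Jr|Jr] := ltnP #|J| r.
    apply: le_trans (contraction_link_le r3 m0 V0 deg_codim2 t1 Jr) _.
    rewrite -mulrA ler_piMr ?(ltW K0) // ler_pdivrMr ?exprn_gt0 // mul1r.
    by rewrite -[leLHS]expr1 ler_weXn2l.
  apply: le_trans (contraction_link_top H m0 V0 t1 Jr) _.
  rewrite -[leLHS]mul1r; apply: ler_pM => //; first exact: ltW.
  by rewrite -[leLHS]expr1 ler_weXn2l.
have link_small (J : {set V}) : (2 <= #|J| < r)%N -> link_sum G p J <= K / m.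
  move=> /andP [J2 Jr]; apply: le_trans (contraction_link_le r3 m0 V0 deg_codim2 t1 Jr) _.
  rewrite -mulrA -/K; apply: ler_pM => //; rewrite ?(ltW K0) //.
    by rewrite divr_ge0 ?exprn_ge0 // ltW.
  rewrite ler_pdivrMr ?exprn_gt0 // mulrC ler_pdivlMr // -expr2.
  by rewrite ler_weXn2l.
have Kbig : 16 * (K * (2 ^+ r.+1 * K) * (2 ^+ (r.+1 + r.+1) * K)) <= m.
  have -> : 16 * (K * (2 ^+ r.+1 * K) * (2 ^+ (r.+1 + r.+1) * K)) =
      16 * 2 ^+ (3 * k) * r.+2%:R ^+ 3 * t ^+ (3 * k).
    rewrite /K -/k (_ : (3 * k = k + (k + k))%N); last by rewrite !mulSn mul0n addn0.
    by rewrite !exprD; ring.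
  rewrite /m (_ : (4 * k = k + 3 * k)%N); last by rewrite mulSn.
  rewrite exprD ler_wpM2r ?exprn_ge0 ?(ltW t0) //; apply: le_trans t_large2 _.
  by rewrite -[leLHS]expr1 ler_weXn2l.
have pn0 : 0 < p * n by rewrite pnE mulr_gt0.
have two1 i : 1 <= 2 ^+ i :> R by rewrite exprn_ege1 // ler1n.
have fp : p * n * K * (2 ^+ r.+1 * (K / m)) <= p * n / 16.
  have : 16 * (K * (2 ^+ r.+1 * K)) <= m.
    apply: le_trans Kbig; rewrite ler_pM2l // ler_peMr //.
      by rewrite (mulr_ge0 (ltW K0)) // (mulr_ge0 _ (ltW K0)) // (le_trans _ (two1 _)).
    by apply: le_trans K1 _; rewrite ler_peMl ?(ltW K0) ?two1.
  move=> h; rewrite ler_pdivlMr //.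
  rewrite (_ : _ * 16 = p * n * (16 * (K * (2 ^+ r.+1 * K)) / m)); last by field; rewrite !gt_eqF.
  by rewrite ler_piMr ?(ltW pn0) // ler_pdivrMr // mul1r.
have ft : p * n * K * (2 ^+ r.+1 * K) * (2 ^+ (r.+1 + r.+1) * (K / m)) <= p * n / 16.
  rewrite ler_pdivlMr //.
  rewrite (_ : _ * 16 = p * n * (16 * (K * (2 ^+ r.+1 * K) * (2 ^+ (r.+1 + r.+1) * K)) / m));
    last by field; rewrite !gt_eqF.
  by rewrite ler_piMr ?(ltW pn0) // ler_pdivrMr // mul1r.
have fs : (p * n) ^+ r * expR t / 2 ^+ tau <= p * n / 16.
  have r0 : (0 < r)%N by exact: leq_trans r3.
  have h1 : 16 * (m * t) ^+ r.-1 <= expR t.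
    have -> : (m * t) ^+ r.-1 = t ^+ ((4 * k).+1 * r.-1).
      by rewrite /m -exprSr -exprM.
    have h := exprn_le_fact_expR ((4 * k).+1 * r.-1) (ltW t0).
    rewrite -(ler_pM2r t0) -mulrA -exprSr.
    apply: le_trans (_ : 16 * ((((4 * k).+1 * r.-1).+1)`!%:R * expR t) <= _).
      by rewrite ler_pM2l.
    by rewrite mulrA mulrC ler_pM2l ?expR_gt0.
  (* By h1, exp t exceeds the power of t; and exp (2 t) <= 2^tau as tau >= 4 t. *)
  have h2 : 16 * (m * t) ^+ r.-1 * expR t <= 2 ^+ tau.
    apply: le_trans (_ : expR t * expR t <= _); first by rewrite ler_wpM2r ?expR_ge0.
    by rewrite -expRD expR_le_exp2 //; lra.
  rewrite pnE ler_pdivlMr // -{1}(prednK r0) exprS.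
  rewrite (_ : _ * 16 = m * t * (16 * (m * t) ^+ r.-1 * expR t / 2 ^+ tau)); last by ring.
  rewrite ler_piMr ?mulr_ge0 ?(ltW m0) ?(ltW t0) //.
  by rewrite ler_pdivrMr ?exprn_gt0 // mul1r.
have fe : \sum_(g in G) (p / t) ^+ #|g| <= r.+2%:R * (p * n) / t.
  have -> : p / t = m / n by rewrite /p; field; rewrite !gt_eqF.
  apply: le_trans (contraction_sum_le r3 m0 V0 deg_codim2) _.
  by rewrite pnE mulrA mulfK // gt_eqF.
have C0 : 0 < r.+2%:R :> R by exact: lt_le_trans ltr01 r2.
have few_pairs := le_trans (sum_pairs_le p01 K1 m0 r3 Gsize link_le link_small) fp.
have few_triples := le_trans (sum_triples_le p01 K1 m0 r3 Gsize link_le link_small) ft.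
have few_stars := le_trans (sum_stars_le p01 tau (contraction_ext_le H m0 V0 t1)) fs.
have [W [cW no_bad_pair no_bad_triple small_stars few_edges_inside]] :=
  exists_clean_subset p01 t1 C0 r3 Gsize few_pairs few_triples few_stars fe.
set F := [set g in G | g \subset W] in no_bad_pair no_bad_triple small_stars few_edges_inside.
have inF e : e \in F -> e \in G /\ e \subset W by rewrite inE => /andP.
have tau0 : (0 < tau)%N.
  by rewrite -(ltr0n R); apply: lt_le_trans tau4; rewrite mulr_gt0.
have W0 : (0 < #|W|)%N.
  by rewrite -(ltr0n R); apply: lt_le_trans cW; rewrite divr_gt0.
have alphaP (I : {set V}) : I \subset W ->
    (forall e, e \in F -> ~~ (e \subset I)) -> #|I|%:R <= (alpha H)%:R :> R.
  move=> IW hI; rewrite ler_nat /alpha.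
  apply: (@leq_bigmax_cond _ (independent H) (fun A : {set V} => #|A|) I).
  apply: (@contraction_indep R V r H m) => g gG; have [gW|gW] := boolP (g \subset W).
    by apply: hI; rewrite inE -/G gG.
  by apply: contra gW => gI; exact: subset_trans gI IW.
have Fsize e : e \in F -> (r <= #|e| <= r.+1)%N by case/inF => /Gsize.
have Fanti e g : e \in F -> g \in F -> e \subset g -> e = g.
  by move=> /inF [eG _] /inF [gG _]; exact: (@contraction_anti R V r H m e g eG gG).
have FW e : e \in F -> e \subset W by case/inF.
have := clean_family_alpha_ge r3 Fsize Fanti FW no_bad_pair no_bad_triple small_stars tau0 tau5 W0 few_edges_inside
  alphaP L256 t_large3 uL u1.
apply: le_trans; rewrite -/t -/k.
set c := (1024 * k%:R)^-1 / _.
have c0 : 0 < c.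
  by rewrite /c ?mulr_gt0 ?invr_gt0 ?mulr_gt0 ?ltr0n.
rewrite pnE in cW.
have u0 : 0 < u by exact: lt_le_trans ltr01 u1.
apply: le_trans (_ : c * u / t * (m * t / 2) <= _).
  rewrite le_eqVlt; apply/orP; left; apply/eqP; field.
  by rewrite gt_eqF.
have cut0 : 0 < c * u / t by rewrite divr_gt0 // mulr_gt0.
by rewrite ler_pM2l.
Qed.

End LargeScale.

(** * All scales *)

Lemma powR_inv_expK (R : realType) (x : R) (i : nat) : (0 < i)%N -> 0 <= x ->
  (x `^ i%:R^-1) ^+ i = x.
Proof.
move=> i0 x0; rewrite -powR_mulrn ?powR_ge0 // -powRrM mulVf ?powRr1 //.
by rewrite pnatr_eq0 -lt0n.
Qed.

Lemma expr_powR_invK (R : realType) (x : R) (i : nat) : (0 < i)%N -> 0 <= x ->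
  (x ^+ i) `^ i%:R^-1 = x.
Proof.
move=> i0 x0; rewrite -powR_mulrn // -powRrM mulfV ?powRr1 //.
by rewrite pnatr_eq0 -lt0n.
Qed.

Section DegreeFacts.
Variables (k : nat) (V : finType) (H : kgraph k V).

Lemma deg_le_max_deg (S : {set V}) : (deg H S <= max_deg #|S| H)%N.
Proof.
exact: (@leq_bigmax_cond _ (fun A : {set V} => #|A| == #|S|) (deg H) S).
Qed.

Lemma max_deg_gt0 (l : nat) : (l <= k)%N -> edges H != set0 ->
  (0 < max_deg l H)%N.
Proof.
move=> lk /set0Pn [e eH].
have : (0 < #|[set A : {set V} | A \subset e & #|A| == l]|)%N.
  by rewrite cards_draws (edges_card eH) bin_gt0.
case/card_gt0P => S; rewrite inE => /andP [Se /eqP <-].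
apply: leq_trans (deg_le_max_deg S); apply/card_gt0P.
by exists e; rewrite inE eH.
Qed.

Lemma alpha_gt0 : (1 < k)%N -> (0 < #|V|)%N -> (0 < alpha H)%N.
Proof.
move=> k1 /card_gt0P [v _]; rewrite -(cards1 v).
apply: (@leq_bigmax_cond _ (independent H) (fun A : {set V} => #|A|) [set v]).
apply/forall_inP => e eH; apply/negP => /subset_leq_card.
by rewrite cards1 (edges_card eH) leqNgt k1.
Qed.

End DegreeFacts.

(** For bounded n / d the constant is chosen so that the claim is alpha(H) >= 1.
    Otherwise t = (n / d)^(1 / (4 k r)) is large.  The sampling probability
    m t / n is at most 1, because (m t)^2 <= n / d <= n^2; here 1 <= d n by the
    existence of an edge or by edgeless_scale. *)
Theorem alpha_ge_codegree (R : realType) (r : nat) : (3 <= r)%N ->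
  exists c : R, 0 < c /\
    forall (n : nat) (d : R) (V : finType) (H : kgraph r.+1 V),
      (0 < n)%N -> #|V| = n -> 0 < d -> d <= n%:R ->
      edgeless_scale n d H ->
      (max_deg r.-1 H)%:R <= d * n%:R ->
      c * (n%:R / d * ln (n%:R / d)) `^ (1 / r%:R) <= (alpha H)%:R.
Proof.
move=> r3; have r0 : (0 < r)%N by exact: leq_trans r3.
pose k := r.+1.
pose A1 : R := 16 * (((4 * k).+1 * r.-1).+1)`!%:R.
pose A2 : R := 16 * 2 ^+ (3 * k) * r.+2%:R ^+ 3.
pose A3 : R := (512 * k%:R) ^+ 2 * r.+2%:R.
pose T0 : R := A1 + A2 + A3 + expR 256.
have A10 : 0 <= A1 by rewrite mulr_ge0.
have A20 : 0 <= A2 by rewrite mulr_ge0 ?mulr_ge0 ?exprn_ge0.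
have A30 : 0 <= A3 by rewrite mulr_ge0 ?sqr_ge0.
have e0 : 0 < expR 256 :> R by exact: expR_gt0.
have T00 : 0 < T0 by rewrite /T0; lra.
pose q : nat := (4 * k * r)%N.
have q0 : (0 < q)%N by rewrite !muln_gt0.
pose X := T0 ^+ q.
have X0 : 0 < X by rewrite exprn_gt0.
pose B := (X * X) `^ (1 / r%:R).
have B0 : 0 < B by rewrite powR_gt0 ?mulr_gt0.
pose c1 : R := (1024 * k%:R)^-1 * (512 * k%:R * r.+2%:R)^-1 / 2.
have c10 : 0 < c1 by rewrite /c1 ?mulr_gt0 ?invr_gt0 ?mulr_gt0 ?ltr0n.
pose Q := q%:R `^ (1 / r%:R) : R.
have Q0 : 0 < Q by rewrite powR_gt0 ?ltr0n.
(* The two terms of the minimum serve the ranges t >= T0 and t < T0. *)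
exists (Order.min (c1 / Q) B^-1); split.
  by rewrite lt_min divr_gt0 // invr_gt0.
move=> n d V H n0 Vn d0 dn escale hdeg.
have nR0 : 0 < n%:R :> R by rewrite ltr0n.
set x := n%:R / d.
have x1 : 1 <= x by rewrite ler_pdivlMr // mul1r.
have x0 : 0 < x by exact: lt_le_trans ltr01 x1.
have lx0 : 0 <= ln x by exact: ln_ge0.
have ri0 : 0 <= 1 / r%:R :> R by rewrite divr_ge0.
have dn1 : 1 <= d * n%:R.
  have [/escale //|He] := eqVneq (edges H) set0.
  apply: le_trans hdeg; rewrite ler1n; apply: max_deg_gt0 => //.
  by rewrite (leq_trans (leq_pred r)).
pose L := ln x / q%:R; pose t := expR L.
have qR0 : 0 < q%:R :> R by rewrite ltr0n.
have xt : x = t ^+ q.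
  by rewrite /t -expRM_natl /L mulrC divfK ?gt_eqF // lnK.
have pos : 0 <= (x * ln x) `^ (1 / r%:R) by exact: powR_ge0.
have [small|large] := ltP t T0.
  apply: le_trans (_ : 1 <= _); last first.
    rewrite ler1n; apply: alpha_gt0; last by rewrite Vn.
    by rewrite ltnS.
  apply: le_trans (_ : B^-1 * B <= _); last by rewrite mulVf ?gt_eqF.
  have xX : x <= X.
    by rewrite xt lerXn2r ?nnegrE ?expR_ge0 ?(ltW T00) // ltW.
  apply: ler_pM => //; first by rewrite le_min divr_ge0 ?invr_ge0 ?ltW.
    by rewrite ge_min lexx orbT.
  apply: (ge0_ler_powR ri0).
  - by rewrite nnegrE (mulr_ge0 (ltW x0) lx0).
  - by rewrite nnegrE (mulr_ge0 (ltW X0) (ltW X0)).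
  apply: ler_pM => //; first exact: ltW.
  by apply: le_trans xX; exact: ltW (ln_sublinear x0).
have L256 : 256 <= L.
  by rewrite -ler_expR; apply: le_trans large; rewrite /T0; lra.
have t1 : 1 <= t by apply: le_trans (expR_ge1Dx _); rewrite lerDl; lra.
have t0 : 0 < t by exact: expR_gt0.
have L0 : 0 <= L by lra.
pose u := L `^ r%:R^-1.
have uL : u ^+ r = L by exact: powR_inv_expK.
have u1 : 1 <= u.
  by rewrite -(ler_pXn2r r0) ?nnegrE ?powR_ge0 // expr1n uL; lra.
pose m := t ^+ (4 * k).
have mr : m ^+ r = x by rewrite /m -exprM xt.
have m0 : 0 < m by rewrite exprn_gt0.
have xn : x <= n%:R ^+ 2.
  rewrite ler_pdivrMr // expr2 -mulrA ler_peMr ?(ltW nR0) //.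
  by rewrite mulrC.
have mt : m * t <= n%:R.
  have h1 : (m * t : R) \in Num.nneg by rewrite nnegrE mulr_ge0 // ltW.
  have h2 : (n%:R : R) \in Num.nneg by rewrite nnegrE ltW.
  rewrite -(ler_sqr h1 h2); apply: le_trans xn.
  rewrite /m -exprSr -exprM xt ler_weXn2l // /q /k.
  by clear -r3; nia.
have codim (S : {set V}) : #|S| = r.-1 -> (deg H S)%:R <= #|V|%:R ^+ 2 / m ^+ r :> R.
  move=> Sr; rewrite mr Vn /x.
  have -> : n%:R ^+ 2 / (n%:R / d) = d * n%:R by field; rewrite !gt_eqF.
  by apply: le_trans hdeg; rewrite ler_nat -Sr deg_le_max_deg.
have V0 : (0 < #|V|)%N by rewrite Vn.
have mtV : m * t <= #|V|%:R by rewrite Vn.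
have hA1 : A1 <= t by apply: le_trans large; rewrite /T0; lra.
have hA2 : A2 <= t by apply: le_trans large; rewrite /T0; lra.
have hA3 : A3 <= t by apply: le_trans large; rewrite /T0; lra.
apply: le_trans (large_scale_alpha_ge r3 V0 codim mtV L256 hA1 hA2 hA3 uL u1).
rewrite -/c1 -/m.
have u0 : 0 < u by exact: lt_le_trans ltr01 u1.
have um0 : 0 <= u * m by rewrite mulr_ge0 ?(ltW u0) ?(ltW m0).
have -> : (x * ln x) `^ (1 / r%:R) = Q * (u * m).
  have -> : ln x = q%:R * u ^+ r by rewrite uL /L mulrC divfK // gt_eqF.
  rewrite -mr mulrC -mulrA -exprMn powRM ?exprn_ge0 //.
  by rewrite /Q !div1r expr_powR_invK.
apply: le_trans (_ : c1 / Q * (Q * (u * m)) <= _).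
  by rewrite (ler_wpM2r (mulr_ge0 (ltW Q0) um0)) // ge_min lexx.
by rewrite mulrA divfK ?gt_eqF // mulrA.
Qed.

Theorem theorem1p5 (R : realType) (k : nat) (hk : (4 <= k)%N) :
  (forall eps : R, 0 < eps ->
     exists c : R, 0 < c /\ exists N : nat,
       forall (n : nat) (d : R) (V : finType) (H : kgraph k V),
         (N <= n)%N -> #|V| = n -> 0 < d -> d <= n%:R ->
         edgeless_scale n d H ->
         (max_deg k.-2 H)%:R <= d * n%:R ->
         degree_gap_power n d H eps ->
         c * (n%:R / d * ln (n%:R / d)) `^ (1 / k.-1%:R) <= (alpha H)%:R)
  /\
  (exists c : R, 0 < c /\ exists N : nat,
     forall (n : nat) (d : R) (V : finType) (H : kgraph k V),
       (N <= n)%N -> #|V| = n -> 0 < d -> d <= n%:R ->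
       edgeless_scale n d H ->
       (max_deg k.-2 H)%:R <= d * n%:R ->
       degree_gap_log n d H ->
       no_clean_four_cycle H ->
       c * (n%:R / d * ln (n%:R / d)) `^ (1 / k.-1%:R) <= (alpha H)%:R).
Proof.
case: k hk => // r r3; have [c [c0 Hc]] := @alpha_ge_codegree R r r3.
split=> [eps _|]; exists c; split=> //; exists 1%N => n d V H n1 Vn d0 dn es hd _.
  exact: Hc.
by move=> _; exact: Hc.
Qed.
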